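(* Let $(M,g,J_+,J_-)$ be a (twisted) generalized pseudo-K\''ahler $4$-manifold with Lee forms satisfying $\theta_+=-\theta_-$ and with $g(\theta_+,\theta_+)\neq 0$ at every point, and suppose that $J_+J_-+J_-J_+=2p\,Id$ for a function $p$ with $|p|>1$ at every point. Denote also by $\theta_+$ the vector field $g$-dual to $\theta_+$, and set $$f=p-\sqrt{p^2-1},\quad K=\frac{1}{2\sqrt{p^2-1}}[J_+,J_-],\quad X=(J_++fJ_-)\theta_+,\quad Y=\theta_++K\theta_+ .$$ Then either the null distribution $\mathcal{D}=\mathrm{Span}(X,Y)$ is an Engel structure on a non-empty open subset of $M$, or the flow of $Y$ consists of null-geodesics.
   Context: A (twisted) generalized pseudo-K\''ahler structure on $M$ is described here by its equivalent data: a pseudo-Riemannian metric $g$, two (integrable) complex structures $J_+,J_-$ compatible with $g$ (i.e. $g(J_{\pm}X,J_{\pm}Y)=g(X,Y)$), and a $2$-form $b$ such that $d^+F^+=-d^-F^-=H+db$, where $H$ is a closed $3$-form (the twist), $F^{\pm}(X,Y)=g(J_{\pm}X,Y)$, and $d^{\pm}$ is the imaginary part of the $\overline{\partial}$-operator of $J_{\pm}$, with $d^{\pm}F^{\pm}(X,Y,Z)=-dF^{\pm}(J_{\pm}X,J_{\pm}Y,J_{\pm}Z)$. The Lee form $\theta_{\pm}$ of $(g,J_{\pm})$ is the unique $1$-form with $dF^{\pm}=\theta_{\pm}\wedge F^{\pm}$. The bracket $[J_+,J_-]=J_+J_--J_-J_+$ is the commutator of endomorphisms. An Engel structure on a $4$-manifold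 is a $2$-dimensional distribution $\mathcal{D}$ such that $\mathrm{rank}[\mathcal{D},\mathcal{D}]=3$ and $\mathrm{rank}[\mathcal{D},[\mathcal{D},\mathcal{D}]]=4$ at each point. That the flow of $Y$ consists of null-geodesics means that $g(Y,Y)=0$ and the integral curves of $Y$ are, up to reparametrization, geodesics of the Levi-Civita connection $\nabla$ of $g$, i.e. $\nabla_YY=FY$ for some smooth function $F$. *)

(* Defs.v *)
From HB Require Import structures.
From mathcomp Require Import all_boot all_order all_algebra.
From mathcomp Require Import all_classical all_reals all_analysis.

Set Implicit Arguments.
Unset Strict Implicit.
Unset Printing Implicit Defensive.

Import Order.TTheory GRing.Theory Num.Theory.
Import numFieldNormedType.Exports.

Local Open Scope classical_set_scope.
Local Open Scope ring_scope.

(** Points of R^n and tangent vectors in a chart are column vectors, so that an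
    endomorphism acts by [J *m v] and composition is the matrix product. *)

Notation evec k := (delta_mx k 0).

(* Only meaningful for an open U. *)
Fixpoint Ck_on (R : realType) (n k : nat) (U : set 'cV[R]_n)
    (f : 'cV[R]_n -> R) : Prop :=
  (forall x, U x -> {for x, continuous f}) /\
  match k with
  | 0 => True
  | k'.+1 => forall j : 'I_n,
      (forall x, U x -> derivable f x (evec j)) /\
      Ck_on k' U (fun x => 'D_(evec j) f x)
  end.

Definition smooth_on (R : realType) (n : nat) (U : set 'cV[R]_n)
    (f : 'cV[R]_n -> R) : Prop :=
  forall k, Ck_on k U f.

Definition smooth_mx_on (R : realType) (n a c : nat) (U : set 'cV[R]_n)
    (f : 'cV[R]_n -> 'M[R]_(a, c)) : Prop :=
  forall i j, smooth_on U (fun x => f x i j).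

(** A smooth n-manifold, given by a (not necessarily maximal) smooth atlas.
    [chart_map i] is a homeomorphism from [chart_dom i] onto the open set
    [chart_map i @` chart_dom i], with inverse [chart_inv i]; both maps are
    total functions with irrelevant values elsewhere. *)

Record manifold (R : realType) (n : nat) := Manifold {
  points :> topologicalType;
  chart_ix : Type;
  chart_dom : chart_ix -> set points;
  chart_map : chart_ix -> points -> 'cV[R]_n;
  chart_inv : chart_ix -> 'cV[R]_n -> points;
  manifold_hausdorff : hausdorff_space points;
  manifold_second_countable : @second_countable points;
  chart_dom_cover : forall m, exists i, chart_dom i m;
  chart_dom_open : forall i, open (chart_dom i);
  chart_img_open : forall i, open (chart_map i @` chart_dom i);
  chart_mapK : forall i m, chart_dom i m -> chart_inv i (chart_map i m) = m;
  chart_map_continuous : forall i m, chart_dom i m ->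
    {for m, continuous (chart_map i)};
  chart_inv_continuous : forall i x, (chart_map i @` chart_dom i) x ->
    {for x, continuous (chart_inv i)};
  transition_smooth : forall i j,
    smooth_mx_on [set x | (chart_map i @` chart_dom i) x /\
                          chart_dom j (chart_inv i x)]
      (chart_map j \o chart_inv i)
}.

Arguments chart_ix {R n} _.
Arguments chart_dom {R n _} i.
Arguments chart_map {R n _} i.
Arguments chart_inv {R n _} i.

Definition chart_img (R : realType) (n : nat) (M : manifold R n)
    (i : chart_ix M) : set 'cV[R]_n := chart_map i @` chart_dom i.

Definition overlap (R : realType) (n : nat) (M : manifold R n)
    (i j : chart_ix M) : set 'cV[R]_n :=
  [set x | chart_img i x /\ chart_dom j (chart_inv i x)].

Definition transition (R : realType) (n : nat) (M : manifold R n)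
    (i j : chart_ix M) : 'cV[R]_n -> 'cV[R]_n := chart_map j \o chart_inv i.

Definition push (R : realType) (n : nat) (M : manifold R n) (i j : chart_ix M)
    (x v : 'cV[R]_n) : 'cV[R]_n := 'D_v (transition i j) x.

Definition smooth_fun (R : realType) (n : nat) (M : manifold R n)
    (u : M -> R) : Prop :=
  forall i, smooth_on (chart_img i) (u \o chart_inv i).

(** A tensor field is a family [T] of local expressions: [T i x] is its value,
    in the chart i, at the point of coordinates x. Only the values at x in
    [chart_img i] matter; they are smooth and match under changes of chart. *)

Definition endo_field (R : realType) (n : nat) (M : manifold R n)
    (J : chart_ix M -> 'cV[R]_n -> 'M[R]_n) : Prop :=
  (forall i, smooth_mx_on (chart_img i) (J i)) /\
  (forall i j x v, overlap i j x ->
     J j (transition i j x) *m push i j x v = push i j x (J i x *m v)).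

Definition inner (R : realType) (n : nat) (G : 'M[R]_n) (u v : 'cV[R]_n) : R :=
  (u^T *m G *m v) 0 0.

(* The metric is given by its Gram matrices in the charts. *)
Definition pseudo_metric (R : realType) (n : nat) (M : manifold R n)
    (g : chart_ix M -> 'cV[R]_n -> 'M[R]_n) : Prop :=
  [/\ forall i, smooth_mx_on (chart_img i) (g i),
      forall i x, chart_img i x -> (g i x)^T = g i x,
      forall i x, chart_img i x -> g i x \in unitmx &
      forall i j x u v, overlap i j x ->
        inner (g j (transition i j x)) (push i j x u) (push i j x v) =
        inner (g i x) u v].

Definition kform (R : realType) (n k : nat) (M : manifold R n)
    (w : chart_ix M -> 'cV[R]_n -> ('I_k -> 'cV[R]_n) -> R) : Prop :=
  [/\ forall i v, smooth_on (chart_img i) (fun x => w i x v),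
      forall i x v (j : 'I_k) a u1 u2, chart_img i x ->
        w i x [eta v with j |-> a *: u1 + u2] =
        a * w i x [eta v with j |-> u1] + w i x [eta v with j |-> u2],
      forall i x v (j l : 'I_k), chart_img i x -> j != l -> v j = v l ->
        w i x v = 0 &
      forall i j x v, overlap i j x ->
        w j (transition i j x) (fun l => push i j x (v l)) = w i x v].

(* Exterior derivative; the vectors v are extended to constant fields, whose
   brackets vanish. *)
Definition ext_d (R : realType) (n k : nat)
    (w : 'cV[R]_n -> ('I_k -> 'cV[R]_n) -> R)
    (x : 'cV[R]_n) (v : 'I_k.+1 -> 'cV[R]_n) : R :=
  \sum_(j < k.+1) (-1) ^+ j * 'D_(v j) (fun y => w y (v \o lift j)) x.

(* Exterior product of a 1-form with a k-form. *)
Definition wedge1 (R : realType) (n k : nat)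
    (a : ('I_1 -> 'cV[R]_n) -> R) (w : ('I_k -> 'cV[R]_n) -> R)
    (v : 'I_k.+1 -> 'cV[R]_n) : R :=
  \sum_(j < k.+1) (-1) ^+ j * a (fun=> v j) * w (v \o lift j).

Definition lie (R : realType) (n : nat) (V W : 'cV[R]_n -> 'cV[R]_n)
    (x : 'cV[R]_n) : 'cV[R]_n :=
  'D_(V x) W x - 'D_(W x) V x.

Definition nijenhuis (R : realType) (n : nat) (J : 'cV[R]_n -> 'M[R]_n)
    (V W : 'cV[R]_n -> 'cV[R]_n) (x : 'cV[R]_n) : 'cV[R]_n :=
  lie (fun y => J y *m V y) (fun y => J y *m W y) x
  - J x *m lie (fun y => J y *m V y) W x
  - J x *m lie V (fun y => J y *m W y) x
  - lie V W x.

(* Integrability is the vanishing of the Nijenhuis tensor. *)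
Definition complex_structure (R : realType) (n : nat) (M : manifold R n)
    (J : chart_ix M -> 'cV[R]_n -> 'M[R]_n) : Prop :=
  [/\ endo_field J,
      forall i x, chart_img i x -> J i x *m J i x = - 1%:M &
      forall i V W x, smooth_mx_on (chart_img i) V ->
        smooth_mx_on (chart_img i) W -> chart_img i x ->
        nijenhuis (J i) V W x = 0].

Definition compatible (R : realType) (n : nat) (M : manifold R n)
    (g J : chart_ix M -> 'cV[R]_n -> 'M[R]_n) : Prop :=
  forall i x u v, chart_img i x ->
    inner (g i x) (J i x *m u) (J i x *m v) = inner (g i x) u v.

(* F(X, Y) = g(JX, Y) *)
Definition fundamental_form (R : realType) (n : nat)
    (G J : 'cV[R]_n -> 'M[R]_n) (x : 'cV[R]_n) (v : 'I_2 -> 'cV[R]_n) : R :=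
  inner (G x) (J x *m v ord0) (v ord_max).

(* (d^c F)(X, Y, Z) = - dF(JX, JY, JZ) *)
Definition dc_fundamental (R : realType) (n : nat)
    (G J : 'cV[R]_n -> 'M[R]_n) (x : 'cV[R]_n) (v : 'I_3 -> 'cV[R]_n) : R :=
  - ext_d (fundamental_form G J) x (fun l => J x *m v l).

Record twisted_generalized_pseudo_Kahler (R : realType) (n : nat)
    (M : manifold R n) (g Jp Jm : chart_ix M -> 'cV[R]_n -> 'M[R]_n)
    (b : chart_ix M -> 'cV[R]_n -> ('I_2 -> 'cV[R]_n) -> R)
    (H : chart_ix M -> 'cV[R]_n -> ('I_3 -> 'cV[R]_n) -> R) : Prop := {
  gpK_metric : pseudo_metric g;
  gpK_complexp : complex_structure Jp;
  gpK_complexm : complex_structure Jm;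
  gpK_compatp : compatible g Jp;
  gpK_compatm : compatible g Jm;
  gpK_b : kform b;
  gpK_H : kform H;
  gpK_H_closed : forall i x v, chart_img i x -> ext_d (H i) x v = 0;
  gpK_dcp : forall i x v, chart_img i x ->
    dc_fundamental (g i) (Jp i) x v = H i x v + ext_d (b i) x v;
  gpK_dcm : forall i x v, chart_img i x ->
    - dc_fundamental (g i) (Jm i) x v = H i x v + ext_d (b i) x v
}.

(* dF = theta /\ F *)
Definition Lee_form (R : realType) (n : nat) (M : manifold R n)
    (g J : chart_ix M -> 'cV[R]_n -> 'M[R]_n)
    (theta : chart_ix M -> 'cV[R]_n -> ('I_1 -> 'cV[R]_n) -> R) : Prop :=
  kform theta /\
  forall i x v, chart_img i x ->
    ext_d (fundamental_form (g i) (J i)) x v =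
    wedge1 (theta i x) (fundamental_form (g i) (J i) x) v.

(* The vector t with inner G t v = a v for all v (G symmetric invertible,
   a linear). *)
Definition sharp (R : realType) (n : nat) (G : 'M[R]_n) (a : 'cV[R]_n -> R) :
    'cV[R]_n :=
  invmx G *m \col_k a (evec k).

(* Christoffel symbols of the first kind, raised with the metric. *)
Definition christoffel (R : realType) (n : nat) (G : 'cV[R]_n -> 'M[R]_n)
    (x u v : 'cV[R]_n) : 'cV[R]_n :=
  sharp (G x) (fun w => 2^-1 * ('D_u (fun y => inner (G y) v w) x
                              + 'D_v (fun y => inner (G y) u w) x
                              - 'D_w (fun y => inner (G y) u v) x)).

(* Levi-Civita covariant derivative of W along V. *)
Definition nabla (R : realType) (n : nat) (G : 'cV[R]_n -> 'M[R]_n)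
    (V W : 'cV[R]_n -> 'cV[R]_n) (x : 'cV[R]_n) : 'cV[R]_n :=
  'D_(V x) W x + christoffel G x (V x) (W x).

Definition flow_of_null_geodesics (R : realType) (n : nat) (M : manifold R n)
    (g : chart_ix M -> 'cV[R]_n -> 'M[R]_n)
    (Y : chart_ix M -> 'cV[R]_n -> 'cV[R]_n) : Prop :=
  (forall i x, chart_img i x -> inner (g i x) (Y i x) (Y i x) = 0) /\
  exists F : M -> R, smooth_fun F /\
    forall i x, chart_img i x ->
      nabla (g i) (Y i) (Y i) x = F (chart_inv i x) *: Y i x.

(** A field of tangent subsets [D]: [D i x] is its value, in the chart i, at the
    point of coordinates x. *)

Definition lin_span (R : realType) (n : nat) (S : set 'cV[R]_n) :
    set 'cV[R]_n :=
  [set v | exists s : seq 'cV[R]_n,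
     (forall w, w \in s -> S w) /\ v \in span s].

(* S is a linear subspace of dimension r. *)
Definition has_rank (R : realType) (n r : nat) (S : set 'cV[R]_n) : Prop :=
  exists b : r.-tuple 'cV[R]_n, free b /\ S = [set v | v \in span b].

Definition smooth_section (R : realType) (n : nat) (M : manifold R n)
    (D : chart_ix M -> 'cV[R]_n -> set 'cV[R]_n) (i : chart_ix M)
    (O : set 'cV[R]_n) (V : 'cV[R]_n -> 'cV[R]_n) : Prop :=
  smooth_mx_on O V /\ forall y, O y -> D i y (V y).

(* [D1, D2]: at each point, the span of the brackets of local sections. *)
Definition bracket (R : realType) (n : nat) (M : manifold R n)
    (D1 D2 : chart_ix M -> 'cV[R]_n -> set 'cV[R]_n)
    (i : chart_ix M) (x : 'cV[R]_n) : set 'cV[R]_n :=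
  lin_span [set w | exists O V W,
    [/\ open O /\ O x, O `<=` chart_img i, smooth_section D1 i O V,
        smooth_section D2 i O W & w = lie V W x]].

(* A smooth distribution of rank r on the open subset U of M. *)
Definition tangent_distribution (R : realType) (n : nat) (M : manifold R n)
    (r : nat)
    (U : set M) (D : chart_ix M -> 'cV[R]_n -> set 'cV[R]_n) : Prop :=
  [/\ forall i x, chart_img i x -> U (chart_inv i x) -> has_rank r (D i x),
      forall i x v, chart_img i x -> U (chart_inv i x) -> D i x v ->
        exists O V, [/\ open O /\ O x, O `<=` chart_img i,
                        smooth_section D i O V & V x = v] &
      forall i j x v, overlap i j x -> U (chart_inv i x) -> D i x v ->
        D j (transition i j x) (push i j x v)].

Definition Engel_on (R : realType) (M : manifold R 4) (U : set M)
    (D : chart_ix M -> 'cV[R]_4 -> set 'cV[R]_4) : Prop :=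
  tangent_distribution 2 U D /\
  forall i x, chart_img i x -> U (chart_inv i x) ->
    has_rank 3 (bracket D D i x) /\ has_rank 4 (bracket D (bracket D D) i x).

Definition null_distribution (R : realType) (n : nat) (M : manifold R n)
    (g : chart_ix M -> 'cV[R]_n -> 'M[R]_n) (r : nat)
    (D : chart_ix M -> 'cV[R]_n -> set 'cV[R]_n) : Prop :=
  tangent_distribution r setT D /\
  forall i x u v, chart_img i x -> D i x u -> D i x v -> inner (g i x) u v = 0.

(* Main.v *)
(** Write A = J_+, B = J_-, T for the dual of theta_+, c = 2 theta_+(AX) and
    N = A + fB. Then N^2 = 0, K^2 = 1, K is skew and KN = N = -NK, so that
    X = NT and Y = (1 + K)T lie in the kernel of N, which is the null plane
    D = ker (K - 1). In the frame X, Y, AX, AY the only nonzero products are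
    g(AX, Y) = -g(X, AY) = c.

    Integrability and dF = theta /\ F determine nabla A and nabla B in terms of
    theta. Differentiating NY = 0 along v in D and pairing with T gives
    g(nabla_v Y, X) = |T|^2 theta_+(Av). It follows that [D, D] is orthogonal to
    Y, while g([X, Y], X) = |T|^2 theta_+(AX) does not vanish, so that [D, D] is
    the orthogonal Span(X, Y, AY) of Y. Consider the function
    g([Y, AY], Y) = -g(nabla_Y Y, AY). Where it does not vanish,
    [D, [D, D]] is the whole tangent space and D is Engel. If it vanishes
    identically, nabla_Y Y is orthogonal to X, Y and AY, hence proportional
    to Y. *)

Require Import Defs.
From HB Require Import structures.
From mathcomp Require Import all_boot all_order all_algebra.
From mathcomp Require Import ring lra.
From mathcomp Require Import all_classical all_reals all_analysis.

Set Implicit Arguments.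
Unset Strict Implicit.
Unset Printing Implicit Defensive.

Import Order.TTheory GRing.Theory Num.Theory.
Import numFieldNormedType.Exports.

Local Open Scope classical_set_scope.
Local Open Scope ring_scope.

Section Directional.
Context {R : realType} {V : normedModType R}.
Implicit Types (f : V -> R) (x v : V).

Lemma is_derive_line f x v t : derivable f (x + t *: v) v ->
  is_derive t 1 (fun r : R => f (x + r *: v)) ('D_v f (x + t *: v)).
Proof.
have E : (fun h : R => h^-1 *: (f (x + (h *: 1 + t) *: v) - f (x + t *: v)))
       = (fun h => h^-1 *: (f (h *: v + (x + t *: v)) - f (x + t *: v))).
  apply/funext => h; congr (_ *: (f _ - _)).
  by rewrite scalerDl [h *: 1]mulr1 addrCA.
move=> df; apply: DeriveDef; first by rewrite /derivable /= E.
by rewrite /derive /= E.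
Qed.

Lemma derivable_line f x v t :
  derivable (fun r : R => f (x + r *: v)) t 1 -> derivable f (x + t *: v) v.
Proof.
have E : (fun h : R => h^-1 *: (f (x + (h *: 1 + t) *: v) - f (x + t *: v)))
       = (fun h => h^-1 *: (f (h *: v + (x + t *: v)) - f (x + t *: v))).
  apply/funext => h; congr (_ *: (f _ - _)).
  by rewrite scalerDl [h *: 1]mulr1 addrCA.
by rewrite /derivable /= E.
Qed.

Lemma mvt_dir f x v (a : R) :
  (forall c : R, 0 <= c <= 1 -> derivable f (x + (c * a) *: v) v) ->
  exists2 c : R, 0 <= c <= 1 & f (x + a *: v) - f x = a * 'D_v f (x + (c * a) *: v).
Proof.
move=> df; pose phi (t : R) := f (x + (t * a) *: v).
have dphi (t : R) : 0 <= t <= 1 -> is_derive t 1 phi (a * 'D_v f (x + (t * a) *: v)).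
  move=> t01; have /= h := is_derive_line (df _ t01).
  have d2 : is_derive t 1 (fun r : R => r * a) a.
    have -> : (fun r : R => r * a) = a *: (@id R).
      by apply/funext => r /=; rewrite fctE mulrC.
    by apply: is_derive_eq; rewrite [_ *: _]mulr1.
  by have := @is_derive1_comp _ (fun r : R => f (x + r *: v)) (fun r => r * a)
     t _ _ h d2; rewrite mulrC.
have [c c01 /= E] : exists2 c, c \in `[0, 1]%R &
    phi 1 - phi 0 = (a * 'D_v f (x + (c * a) *: v)) * (1 - 0).
  apply: (@MVT_segment _ phi (fun t => a * 'D_v f (x + (t * a) *: v)) 0 1) => //.
    by move=> t; rewrite in_itv /= => /andP[? ?]; apply: dphi; rewrite !ltW.
  apply: derivable_within_continuous => t; rewrite in_itv /= => t01.
  by have [] := dphi _ t01.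
exists c; first by move: c01; rewrite in_itv.
by move: E; rewrite /phi mul1r mul0r scale0r addr0 subr0 mulr1.
Qed.

End Directional.

(** * Functions of class Ck on an open set *)

Section Ck.
Context {R : realType} {n : nat}.
Implicit Types (U : set 'cV[R]_n) (f g : 'cV[R]_n -> R) (k : nat).

Lemma Ck_on_continuous k U f x : Ck_on k U f -> U x -> {for x, continuous f}.
Proof. by case: k => [|k] [+ _]; apply. Qed.

Lemma Ck_onS k U f : Ck_on k.+1 U f -> Ck_on k U f.
Proof.
elim: k f => [|k IH] f [fc df]; split => // j.
by have [dj Cj] := df j; split=> //; exact: IH.
Qed.

Lemma Ck_on_sub k U U' f : U' `<=` U -> Ck_on k U f -> Ck_on k U' f.
Proof.
move=> UU'; elim: k f => [|k IH] f [fc df]; split => //.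
- by move=> x /UU'; exact: fc.
- by move=> x /UU'; exact: fc.
by move=> j; have [dj Cj] := df j; split; [move=> x /UU'; exact: dj|exact: IH].
Qed.

Lemma Ck_on_eq k U f g : open U -> (forall x, U x -> f x = g x) ->
  Ck_on k U f -> Ck_on k U g.
Proof.
move=> oU; have nU x : U x -> \forall y \near x, U y.
  by move=> Ux; apply: open_nbhs_nbhs.
elim: k f g => [|k IH] f g fg [fc df].
  split=> // x Ux; have fgx : \forall y \near x, f y = g y.
    by near=> y; apply: fg; near: y; exact: nU.
  rewrite /prop_for /continuous_at -fg//.
  exact: cvg_trans (near_eq_cvg fgx) (fc x Ux).
split=> [x Ux|j].
  have fgx : \forall y \near x, f y = g y.
    by near=> y; apply: fg; near: y; exact: nU.
  rewrite /prop_for /continuous_at -fg//.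
  exact: cvg_trans (near_eq_cvg fgx) (fc x Ux).
have [dj Cj] := df j.
have fgx x : U x -> \forall y \near x, f y = g y.
  by move=> Ux; near=> y; apply: fg; near: y; exact: nU.
split=> [x Ux|]; first by apply: near_eq_derivable (dj x Ux); exact: fgx.
by apply: IH Cj => x Ux; apply: near_eq_derive; exact: fgx.
Unshelve. all: by end_near. Qed.

Lemma Ck_on_cst k U (c : R) : Ck_on k U (cst c).
Proof.
elim: k c => [|k IH] c; (split; first by move=> x _; apply: cst_continuous) => // j.
split=> [x _|]; first exact: derivable_cst.
by rewrite (_ : (fun _ => _) = cst 0) //; apply/funext => x; rewrite derive_cst.
Qed.

Lemma Ck_onD k U f g : open U ->
  Ck_on k U f -> Ck_on k U g -> Ck_on k U (fun x => f x + g x).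
Proof.
move=> oU; elim: k f g => [|k IH] f g Cf Cg.
  by split=> // x Ux; exact: (continuousD (Ck_on_continuous Cf Ux) (Ck_on_continuous Cg Ux)).
split=> [x Ux|j]; first by exact: (continuousD (Ck_on_continuous Cf Ux) (Ck_on_continuous Cg Ux)).
case: Cf Cg => [_ /(_ j)[df Cf]] [_ /(_ j)[dg Cg]].
split=> [x Ux|]; first exact: derivableD (df x Ux) (dg x Ux).
apply: Ck_on_eq (IH _ _ Cf Cg) => // x Ux.
exact/esym/deriveD/dg/Ux/df.
Qed.

Lemma Ck_onM k U f g : open U ->
  Ck_on k U f -> Ck_on k U g -> Ck_on k U (fun x => f x * g x).
Proof.
move=> oU; elim: k f g => [|k IH] f g Cf Cg.
  by split=> // x Ux; exact: (continuousM (Ck_on_continuous Cf Ux) (Ck_on_continuous Cg Ux)).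
split=> [x Ux|j]; first by exact: (continuousM (Ck_on_continuous Cf Ux) (Ck_on_continuous Cg Ux)).
have [Cf' Cg'] := (Ck_onS Cf, Ck_onS Cg).
case: Cf Cg => [_ /(_ j)[df Cf]] [_ /(_ j)[dg Cg]].
split=> [x Ux|]; first exact: derivableM (df x Ux) (dg x Ux).
apply: Ck_on_eq (Ck_onD oU (IH _ _ Cf' Cg) (IH _ _ Cg' Cf)) => // x Ux.
exact/esym/deriveM/dg/Ux/df.
Qed.

Lemma Ck_onV k U f : open U -> (forall x, U x -> f x != 0) ->
  Ck_on k U f -> Ck_on k U (fun x => (f x)^-1).
Proof.
move=> oU f0; elim: k => [|k IH] Cf.
  by split=> // x Ux; exact: (continuousV (f0 _ Ux) (Ck_on_continuous Cf Ux)).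
have Cf' := IH (Ck_onS Cf).
split=> [x Ux|j]; first exact: Ck_on_continuous Cf' Ux.
case: Cf => [_ /(_ j)[df Cf]].
split=> [x Ux|]; first exact: derivableV (f0 _ Ux) (df x Ux).
apply: Ck_on_eq (Ck_onM oU (Ck_on_cst k U (-1))
  (Ck_onM oU (Ck_onM oU Cf' Cf') Cf)) => // x Ux.
rewrite deriveV ?f0//; last exact: df.
by rewrite /cst mulN1r scaleNr -invfM -expr2.
Qed.

Lemma Ck_on_sqrt k U f : open U -> (forall x, U x -> 0 < f x) ->
  Ck_on k U f -> Ck_on k U (fun x => Num.sqrt (f x)).
Proof.
move=> oU f0.
have cs x : U x -> {for x, continuous f} ->
    {for x, continuous (fun x => Num.sqrt (f x))}.
  by move=> Ux fc; apply: continuous_comp fc _; exact: sqrt_continuous.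
elim: k => [|k IH] Cf.
  by split=> // x Ux; apply: cs => //; exact: Ck_on_continuous Cf Ux.
have Cf' := IH (Ck_onS Cf).
split=> [x Ux|j]; first exact: Ck_on_continuous Cf' Ux.
case: Cf => [_ /(_ j)[df Cf]].
have ds x : U x -> is_derive x (evec j) (fun x => Num.sqrt (f x))
    ((2 * Num.sqrt (f x))^-1 * 'D_(evec j) f x).
  move=> Ux; have := df x Ux.
  rewrite -{1}[x]addr0 -(scale0r (evec j)) => /is_derive_line dl.
  have f00 : 0 < f (x + (0 : R) *: evec j) by rewrite scale0r addr0 f0.
  have := is_derive1_comp (is_derive1_sqrt f00) dl.
  rewrite scale0r addr0 => -[dd ed].
  have := @derivable_line _ _ (fun x => Num.sqrt (f x)) x (evec j) 0 dd.
  rewrite scale0r addr0 => D; split => //; rewrite -ed /=.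
  have := D; rewrite -{1}[x]addr0 -(scale0r (evec j)) => /is_derive_line.
  by rewrite scale0r addr0 => -[_ <-].
split=> [x /ds[]//|].
have s0 x : U x -> 2 * Num.sqrt (f x) != 0.
  by move=> Ux; rewrite mulf_neq0// gt_eqF// sqrtr_gt0 f0.
apply: Ck_on_eq (Ck_onM oU (Ck_onV oU s0
  (Ck_onM oU (Ck_on_cst k U 2) Cf')) Cf) => // x Ux.
by have [_ ->] := ds _ Ux.
Qed.

Lemma Ck_on_sum (I : Type) (r : seq I) (P : pred I) (F : I -> 'cV[R]_n -> R) k U :
  open U -> (forall i, Ck_on k U (F i)) ->
  Ck_on k U (fun x => \sum_(i <- r | P i) F i x).
Proof.
move=> oU CF; elim: r => [|i r IH].
  by under eq_fun do rewrite big_nil; exact: Ck_on_cst.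
under eq_fun do rewrite big_cons.
by case: (P i) => //; exact: Ck_onD.
Qed.

Lemma Ck_on_prod (I : Type) (r : seq I) (P : pred I) (F : I -> 'cV[R]_n -> R) k U :
  open U -> (forall i, Ck_on k U (F i)) ->
  Ck_on k U (fun x => \prod_(i <- r | P i) F i x).
Proof.
move=> oU CF; elim: r => [|i r IH].
  by under eq_fun do rewrite big_nil; exact: Ck_on_cst.
under eq_fun do rewrite big_cons.
by case: (P i) => //; exact: Ck_onM.
Qed.

End Ck.

Section Differentiability.
Context {R : realType} {n : nat}.
Implicit Types (U : set 'cV[R]_n) (f g : 'cV[R]_n -> R) (x h v : 'cV[R]_n).

Lemma ler_mx_norm_entry v i : `|v i 0| <= `|v|.
Proof.
by rewrite [leRHS]/Num.Def.normr/= mx_normrE (le_bigmax _ _ (i, 0)).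
Qed.

Lemma mx_norm_ler v (c : R) : 0 <= c -> (forall i, `|v i 0| <= c) -> `|v| <= c.
Proof.
move=> c0 vc; rewrite [leLHS]/Num.Def.normr/= mx_normrE bigmax_le// => -[i j] _.
by rewrite /= [j]ord1.
Qed.

Lemma ler_divMn (a c : R) : 0 <= a -> 0 <= c -> (a / n.+1%:R * c) *+ n <= a * c.
Proof.
move=> a0 c0; rewrite -mulr_natl mulrA ler_wpM2r// mulrCA ler_piMr//.
by rewrite ler_pdivrMr// mul1r ler_nat.
Qed.

Lemma ler_norm_scale_evec (c t : R) (k : 'I_n) : 0 <= c -> c <= 1 ->
  `|(c * t) *: (evec k : 'cV[R]_n)| <= `|t|.
Proof.
move=> c0 c1; apply: mx_norm_ler => // i; rewrite !mxE eqxx andbT.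
case: (i == k); last by rewrite mulr0 normr0.
by rewrite mulr1 normrM ger0_norm// ler_piMl.
Qed.

Lemma dnbhs0_ex2 (P Q : R -> Prop) :
  (\forall t \near (0 : R)^', P t) -> (\forall t \near (0 : R)^', Q t) ->
  exists t, P t /\ Q t.
Proof.
by move=> p q; near (0 : R)^' => t; exists t; split; near: t.
Unshelve. all: by end_near. Qed.

Lemma near_normP x (P : set 'cV[R]_n) : nbhs x P ->
  exists2 d : R, 0 < d & forall y, `|x - y| < d -> P y.
Proof.
move=> /nbhs_ballP[d /= d0 dP]; exists d => // y xy.
by apply: dP; rewrite -ball_normE.
Qed.

Lemma Ck1_differentiable U f x :
  open U -> Ck_on 1 U f -> U x -> differentiable f x.
Proof.
move=> oU [_ df] Ux.
pose L h : R := \sum_k h k 0 * 'D_(evec k) f x.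
have Llin : linear L.
  move=> a u v; rewrite /L scaler_sumr -big_split; apply: eq_bigr => k _ /=.
  by rewrite !mxE mulrDl -mulrA.
pose LM := GRing.isLinear.Build _ _ _ _ _ Llin.
pose Ll : {linear 'cV[R]_n -> R} := HB.pack L LM.
have Lc : continuous L.
  move=> h; apply: differentiable_continuous.
  have -> : L = \sum_(k < n) (fun v => v k 0 * 'D_(evec k) f x).
    by apply/funext => v; rewrite fct_sumE.
  apply: differentiable_sum => k; apply: differentiableM => //.
  exact: differentiable_coord.
suff E : (f : 'cV[R]_n -> R^o) \o shift x =
    cst (f x) + (Ll : 'cV[R]_n -> R^o) +o_ (0 : 'cV[R]_n) id.
  by apply/diff_locallyP; rewrite (diff_unique _ E)//; exact: Lc.
apply/eqaddoP => _/posnumP[e].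
have e'0 : 0 < e%:num / n.+1%:R by rewrite divr_gt0.
have nD : \forall y \near x, forall k,
    `|'D_(evec k) f x - 'D_(evec k) f y| <= e%:num / n.+1%:R.
  apply: (@filter_forall _ _ (fun k y =>
    `|'D_(evec k) f x - 'D_(evec k) f y| <= e%:num / n.+1%:R) _ (nbhs_filter x)) => k.
  have [_ [Dc _]] := df k.
  by move: (Dc x Ux) => /cvgrPdist_le /(_ _ e'0).
have nU : \forall y \near x, U y by apply: open_nbhs_nbhs.
have [d d0 dP] := near_normP (filterI nU nD).
have nd : \forall h \near (0 : 'cV[R]_n), `|h| < d by exact: nbhs0_lt.
near=> h.
have hd : `|h| < d.
  by near: h; exact: nd.
pose hh k : 'cV[R]_n := \col_i (if (i < k)%N then h i 0 else 0).
have hhn : hh n = h by apply/colP => i; rewrite mxE ltn_ord.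
have hh0 : hh 0%N = 0 by apply/colP => i; rewrite !mxE.
have hhS (k : 'I_n) : hh k.+1 = hh k + h k 0 *: evec k.
  apply/colP => i; rewrite !mxE eqxx andbT ltnS leq_eqVlt.
  have [->|ik] := eqVneq i k; first by rewrite ltnn eqxx/= mulr1 add0r.
  by rewrite -val_eqE/= in ik; rewrite (negbTE ik) mulr0 addr0.
have step (k : 'I_n) : exists2 y, `|x - y| < d &
    f (x + hh k.+1) - f (x + hh k) = h k 0 * 'D_(evec k) f y.
  have B (c : R) : 0 <= c <= 1 -> `|x - (x + hh k + (c * h k 0) *: evec k)| < d.
    move=> /andP[c0 c1]; apply: le_lt_trans hd.
    rewrite opprD addrA opprD addrA subrr sub0r -opprD normrN.
    apply: mx_norm_ler => // i; rewrite !mxE eqxx andbT.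
    have [->|ik] := eqVneq i k.
      rewrite ltnn add0r mulr1 normrM ger0_norm// (le_trans _ (ler_mx_norm_entry _ k))//.
      by rewrite ler_piMl.
    rewrite mulr0 addr0; case: ifP => _; first exact: ler_mx_norm_entry.
    by rewrite normr0.
  have [|c c01 E] := @mvt_dir _ _ f (x + hh k) (evec k) (h k 0).
    by move=> c /B/dP[Uy _]; have [+ _] := df k; apply.
  by exists (x + hh k + (c * h k 0) *: evec k); [exact: B|rewrite hhS addrA].
have -> : (f \o shift x - (cst (f x) + Ll)) h =
    \sum_(k < n) (f (x + hh k.+1) - f (x + hh k) - h k 0 * 'D_(evec k) f x).
  rewrite big_split/= sumrN -(big_mkord xpredT (fun k => f (x + hh k.+1) - f (x + hh k))).
  rewrite telescope_sumr// hhn hh0 addr0 [in RHS](addrC x).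
  by rewrite !fctE opprD addrA.
rewrite (le_trans (ler_norm_sum _ _ _))//.
have H (k : 'I_n) : `|f (x + hh k.+1) - f (x + hh k) - h k 0 * 'D_(evec k) f x| <=
    e%:num / n.+1%:R * `|h|.
  have [y /dP[_ /(_ k) Dy] ->] := step k.
  rewrite -mulrBr normrM mulrC ler_pM// ?ler_mx_norm_entry//.
  by rewrite distrC.
apply: le_trans (ler_sum _ (fun k _ => H k)) _.
by rewrite sumr_const card_ord; exact: ler_divMn.
Unshelve. all: by end_near. Qed.

Definition diff2 f x (i j : 'I_n) (t : R) :=
  (f (x + t *: evec i + t *: evec j) - f (x + t *: evec i)
   - f (x + t *: evec j) + f x) / (t * t).

Lemma diff2C f x i j t : diff2 f x i j t = diff2 f x j i t.
Proof.
have swap (a b c d e : R) : (a - b - c + d) / e = (a - c - b + d) / e.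
  by rewrite (addrAC a).
by rewrite /diff2 (addrAC x) swap.
Qed.

Lemma diff2_near U f x (i j : 'I_n) (eps : R) :
  open U -> Ck_on 2 U f -> U x -> 0 < eps ->
  \forall t \near (0 : R)^',
    `|diff2 f x i j t - 'D_(evec i) (fun y => 'D_(evec j) f y) x| <= eps.
Proof.
move=> oU C2 Ux eps0.
have Cj := C2.2 j; have [dj Cj'] := Cj; have [_ [_ [Cij _]]] := (Cj'.1, Cj'.2 i).
have nD : \forall y \near x,
  `|'D_(evec i) (fun y => 'D_(evec j) f y) x -
    'D_(evec i) (fun y => 'D_(evec j) f y) y| <= eps.
  by move: (Cij x Ux) => /cvgrPdist_le /(_ _ eps0).
have nU : \forall y \near x, U y by apply: open_nbhs_nbhs.
have [d d0 dP] := near_normP (filterI nU nD).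
near=> t.
have t0 : t != 0 by near: t; exact: nbhs_dnbhs_neq.
have td : `|t| + `|t| < d.
  have : `|t| < d / 2 by near: t; apply: dnbhs0_lt; rewrite divr_gt0.
  by lra.
have B (a c : R) : 0 <= a <= 1 -> 0 <= c <= 1 ->
    `|x - (x + (a * t) *: evec i + (c * t) *: evec j)| < d.
  move=> /andP[a0 a1] /andP[c0 c1]; apply: le_lt_trans td.
  rewrite opprD addrA opprD addrA subrr sub0r -opprD normrN.
  apply: le_trans (ler_normD _ _) _.
  by apply: lerD; exact: ler_norm_scale_evec.
have t01 : 0 <= (1 : R) <= 1 by rewrite ler01 lexx.
have t00 : 0 <= (0 : R) <= 1 by rewrite ler01 lexx.
pose ph y := f (y + t *: evec i) - f y.
have dph (c : R) : 0 <= c <= 1 -> is_derive (x + (c * t) *: evec j) (evec j) ph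
    ('D_(evec j) f (x + t *: evec i + (c * t) *: evec j) - 'D_(evec j) f (x + (c * t) *: evec j)).
  move=> c01.
  have U1 : U (x + (c * t) *: evec j).
    by have := B _ _ t00 c01; rewrite mul0r scale0r addr0 => /dP[].
  have U2 : U (x + t *: evec i + (c * t) *: evec j).
    by have := B _ _ t01 c01; rewrite mul1r => /dP[].
  apply: is_deriveB; last by apply: DeriveDef => //; exact: dj.
  have E : (fun h : R => h^-1 *: (f (h *: evec j + (x + (c * t) *: evec j) + t *: evec i) -
        f (x + (c * t) *: evec j + t *: evec i))) =
      (fun h : R => h^-1 *: (f (h *: evec j + (x + t *: evec i + (c * t) *: evec j)) -
        f (x + t *: evec i + (c * t) *: evec j))).
    apply/funext => h; rewrite -!addrA [_ *: evec i + _ *: evec j]addrC.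
    by [].
  have := dj _ U2; rewrite /derivable => D.
  by apply: DeriveDef; rewrite /derivable /derive /= E.
have [|c c01 E1] := @mvt_dir _ _ ph x (evec j) t; first by move=> c /dph[].
have [_ E2] := dph c c01.
have [|a a01 E3] := @mvt_dir _ _ (fun y => 'D_(evec j) f y) (x + (c * t) *: evec j) (evec i) t.
  move=> a a01; have /dP[Uxx _] := B _ _ a01 c01.
  by rewrite (addrAC x) in Uxx; exact: (Cj'.2 i).1.
have E : diff2 f x i j t =
    'D_(evec i) (fun y => 'D_(evec j) f y) (x + (a * t) *: evec i + (c * t) *: evec j).
  have QQ : f (x + t *: evec i + t *: evec j) -
      f (x + t *: evec i) - f (x + t *: evec j) + f x = ph (x + t *: evec j) - ph x.
    have sw (u v w z : R) : u - v - w + z = u - w - (v - z) by ring.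
    by rewrite /ph (addrAC x (t *: evec j)) sw.
  rewrite /diff2 QQ E1 E2 (addrAC x (t *: evec i)) E3 (addrAC x (_ *: evec j)).
  have sw (u z : R) : u != 0 -> u * (u * z) / (u * u) = z by move=> u0; field.
  exact: sw.
by rewrite E distrC; have [] := dP _ (B _ _ a01 c01).
Unshelve. all: by end_near. Qed.

Lemma clairaut U f x (i j : 'I_n) : open U -> Ck_on 2 U f -> U x ->
  'D_(evec i) (fun y => 'D_(evec j) f y) x =
  'D_(evec j) (fun y => 'D_(evec i) f y) x.
Proof.
move=> oU C2 Ux.
apply/eqP; rewrite -subr_eq0 -normr_eq0 eq_le normr_ge0 andbT.
apply/ler_addgt0Pr => e e0; rewrite add0r.
have e20 : 0 < e / 2 by rewrite divr_gt0.
have nij := diff2_near i j oU C2 Ux e20.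
have : \forall t \near (0 : R)^',
    `|diff2 f x i j t - 'D_(evec j) (fun y => 'D_(evec i) f y) x| <= e / 2.
  by apply: filterS (diff2_near j i oU C2 Ux e20) => t; rewrite (diff2C f x j i).
move=> nji.
have [t [h1 h2]] := dnbhs0_ex2 nij nji.
move: h1 h2; move: (diff2 f x i j t) ('D_(evec i) _ x) ('D_(evec j) _ x).
move=> q u w h1 h2; rewrite (splitr e) -(subrKA q).
by rewrite (le_trans (ler_normD _ _))// lerD// distrC.
Qed.

End Differentiability.

Section DirectionalLinear.
Context {R : realType} {V W : normedModType R}.
Implicit Types (f : V -> W) (x u v : V).

Lemma derive_dirD f x u v : differentiable f x ->
  'D_(u + v) f x = 'D_u f x + 'D_v f x.
Proof. by move=> df; rewrite !deriveE// linearD. Qed.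

Lemma derive_dirZ f x (c : R) v : differentiable f x ->
  'D_(c *: v) f x = c *: 'D_v f x.
Proof. by move=> df; rewrite !deriveE// linearZ. Qed.

Lemma derive_dirN f x v : differentiable f x -> 'D_(- v) f x = - 'D_v f x.
Proof. by move=> df; rewrite !deriveE// linearN. Qed.

Lemma derive_dir_sum f x (I : Type) (r : seq I) (v : I -> V) : differentiable f x ->
  'D_(\sum_(i <- r) v i) f x = \sum_(i <- r) 'D_(v i) f x.
Proof.
move=> df; rewrite deriveE// linear_sum; apply: eq_bigr => i _.
by rewrite deriveE.
Qed.

End DirectionalLinear.

Lemma derive_entry (R : realType) (V : normedModType R) (a c : nat)
    (F : V -> 'M[R]_(a, c)) x v i j : derivable F x v ->
  ('D_v F x) i j = 'D_v (fun y => F y i j) x.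
Proof. by move=> dF; rewrite derive_mx// mxE. Qed.

Section Smooth.
Context {R : realType} {n : nat}.
Implicit Types (U : set 'cV[R]_n) (f g : 'cV[R]_n -> R).

Lemma smooth_on_sub U U' f : U' `<=` U -> smooth_on U f -> smooth_on U' f.
Proof. by move=> UU' sf k; exact: Ck_on_sub (sf k). Qed.

Lemma smooth_on_eq U f g : open U -> (forall x, U x -> f x = g x) ->
  smooth_on U f -> smooth_on U g.
Proof. by move=> oU fg sf k; exact: Ck_on_eq (sf k). Qed.

Lemma smooth_on_cst U (c : R) : smooth_on U (fun=> c).
Proof. by move=> k; exact: Ck_on_cst. Qed.

Lemma smooth_onD U f g : open U ->
  smooth_on U f -> smooth_on U g -> smooth_on U (fun x => f x + g x).
Proof. by move=> oU sf sg k; exact: Ck_onD. Qed.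

Lemma smooth_onM U f g : open U ->
  smooth_on U f -> smooth_on U g -> smooth_on U (fun x => f x * g x).
Proof. by move=> oU sf sg k; exact: Ck_onM. Qed.

Lemma smooth_onN U f : open U -> smooth_on U f -> smooth_on U (fun x => - f x).
Proof.
move=> oU sf; under eq_fun do rewrite -mulN1r.
by apply: smooth_onM => //; exact: smooth_on_cst.
Qed.

Lemma smooth_onV U f : open U -> (forall x, U x -> f x != 0) ->
  smooth_on U f -> smooth_on U (fun x => (f x)^-1).
Proof. by move=> oU f0 sf k; exact: Ck_onV. Qed.

Lemma smooth_on_sqrt U f : open U -> (forall x, U x -> 0 < f x) ->
  smooth_on U f -> smooth_on U (fun x => Num.sqrt (f x)).
Proof. by move=> oU f0 sf k; exact: Ck_on_sqrt. Qed.

Lemma smooth_on_sum (I : Type) (r : seq I) (P : pred I)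
    (F : I -> 'cV[R]_n -> R) U : open U -> (forall i, smooth_on U (F i)) ->
  smooth_on U (fun x => \sum_(i <- r | P i) F i x).
Proof. by move=> oU sF k; apply: Ck_on_sum => // i; exact: sF. Qed.

Lemma smooth_on_prod (I : Type) (r : seq I) (P : pred I)
    (F : I -> 'cV[R]_n -> R) U : open U -> (forall i, smooth_on U (F i)) ->
  smooth_on U (fun x => \prod_(i <- r | P i) F i x).
Proof. by move=> oU sF k; apply: Ck_on_prod => // i; exact: sF. Qed.

Lemma smooth_differentiable U f x : open U -> smooth_on U f -> U x ->
  differentiable f x.
Proof. by move=> oU sf; exact: Ck1_differentiable. Qed.

Lemma smooth_on_partial U f j : smooth_on U f ->
  smooth_on U (fun x => 'D_(evec j) f x).
Proof. by move=> sf k; exact: ((sf k.+1).2 j).2. Qed.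

Lemma cV_sum_evec (v : 'cV[R]_n) : v = \sum_k v k 0 *: evec k.
Proof. by rewrite {1}[v]matrix_sum_delta exchange_big big_ord1. Qed.

Lemma derive_partials f x v : differentiable f x ->
  'D_v f x = \sum_k v k 0 * 'D_(evec k) f x.
Proof.
move=> df; rewrite {1}[v]cV_sum_evec derive_dir_sum//.
by apply: eq_bigr => k _; rewrite derive_dirZ.
Qed.

End Smooth.

Section SmoothMx.
Context {R : realType} {n : nat}.
Implicit Types (U : set 'cV[R]_n).

Section Dims.
Variables a c : nat.
Implicit Types (F G : 'cV[R]_n -> 'M[R]_(a, c)).

Lemma smooth_mx_on_sub U U' F : U' `<=` U -> smooth_mx_on U F -> smooth_mx_on U' F.
Proof. by move=> UU' sF i j; exact: smooth_on_sub (sF i j). Qed.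

Lemma smooth_mx_on_eq U F G : open U -> (forall x, U x -> F x = G x) ->
  smooth_mx_on U F -> smooth_mx_on U G.
Proof.
by move=> oU FG sF i j; apply: smooth_on_eq (sF i j) => // x Ux; rewrite FG.
Qed.

Lemma smooth_mx_on_cst U (A : 'M[R]_(a, c)) : smooth_mx_on U (fun=> A).
Proof. by move=> i j; exact: smooth_on_cst. Qed.

Lemma smooth_mx_onD U F G : open U ->
  smooth_mx_on U F -> smooth_mx_on U G -> smooth_mx_on U (fun x => F x + G x).
Proof.
by move=> oU sF sG i j; under eq_fun do rewrite mxE; exact: smooth_onD.
Qed.

Lemma smooth_mx_onN U F : open U ->
  smooth_mx_on U F -> smooth_mx_on U (fun x => - F x).
Proof. by move=> oU sF i j; under eq_fun do rewrite mxE; exact: smooth_onN. Qed.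

Lemma smooth_mx_onB U F G : open U ->
  smooth_mx_on U F -> smooth_mx_on U G -> smooth_mx_on U (fun x => F x - G x).
Proof. by move=> oU sF sG; apply: smooth_mx_onD => //; exact: smooth_mx_onN. Qed.

Lemma smooth_mx_onZ U (f : 'cV[R]_n -> R) F : open U ->
  smooth_on U f -> smooth_mx_on U F -> smooth_mx_on U (fun x => f x *: F x).
Proof.
by move=> oU sf sF i j; under eq_fun do rewrite mxE; exact: smooth_onM.
Qed.

Lemma smooth_mx_on_tr U F : smooth_mx_on U F -> smooth_mx_on U (fun x => (F x)^T).
Proof. by move=> sF i j; under eq_fun do rewrite mxE; exact: sF. Qed.

Lemma mx_sum_delta_fun F : F = fun x => \sum_(i < a) \sum_(j < c) F x i j *: delta_mx i j.
Proof. by apply/funext => x; exact: matrix_sum_delta. Qed.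

Lemma differentiable_mx F x :
  (forall i j, differentiable (fun y => F y i j) x) -> differentiable F x.
Proof.
move=> dF; rewrite (mx_sum_delta_fun F).
have -> : (fun x => \sum_(i < a) \sum_(j < c) F x i j *: delta_mx i j) =
    \sum_(i < a) \sum_(j < c) (fun x => F x i j *: delta_mx i j).
  by apply/funext => y; rewrite fct_sumE; under [RHS]eq_bigr do rewrite fct_sumE.
apply: differentiable_sum => i; apply: differentiable_sum => j.
exact: differentiableZl.
Qed.

Lemma smooth_mx_differentiable U F x : open U -> smooth_mx_on U F -> U x ->
  differentiable F x.
Proof.
move=> oU sF Ux; apply: differentiable_mx => i j.
exact: smooth_differentiable Ux.
Qed.

Lemma smooth_on_derive U f (V : 'cV[R]_n -> 'cV[R]_n) : open U ->
  smooth_on U f -> smooth_mx_on U V -> smooth_on U (fun x => 'D_(V x) f x).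
Proof.
move=> oU sf sV.
apply: (@smooth_on_eq _ _ _ (fun x => \sum_k V x k 0 * 'D_(evec k) f x)) => //.
  by move=> x Ux; rewrite -derive_partials//; exact: smooth_differentiable Ux.
by apply: smooth_on_sum => // k; apply: smooth_onM => //; exact: smooth_on_partial.
Qed.

Lemma smooth_mx_on_derive U F (V : 'cV[R]_n -> 'cV[R]_n) : open U ->
  smooth_mx_on U F -> smooth_mx_on U V -> smooth_mx_on U (fun x => 'D_(V x) F x).
Proof.
move=> oU sF sV i j.
apply: (@smooth_on_eq _ _ _ (fun x => 'D_(V x) (fun y => F y i j) x)) => //.
  move=> x Ux; rewrite -derive_entry//; apply: diff_derivable.
  exact: smooth_mx_differentiable Ux.
exact: smooth_on_derive.
Qed.

End Dims.

Lemma smooth_mx_onM a b c U (F : 'cV[R]_n -> 'M[R]_(a, b))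
    (G : 'cV[R]_n -> 'M[R]_(b, c)) : open U ->
  smooth_mx_on U F -> smooth_mx_on U G -> smooth_mx_on U (fun x => F x *m G x).
Proof.
move=> oU sF sG i j; under eq_fun do rewrite mxE.
by apply: smooth_on_sum => // k; exact: smooth_onM.
Qed.

Lemma smooth_on_det a U (F : 'cV[R]_n -> 'M[R]_a) : open U ->
  smooth_mx_on U F -> smooth_on U (fun x => \det (F x)).
Proof.
move=> oU sF; apply: smooth_on_sum => // s; apply: smooth_onM => //.
  exact: smooth_on_cst.
by apply: smooth_on_prod => // i; exact: sF.
Qed.

Lemma smooth_mx_on_inv a U (F : 'cV[R]_n -> 'M[R]_a) : open U ->
  (forall x, U x -> F x \in unitmx) ->
  smooth_mx_on U F -> smooth_mx_on U (fun x => invmx (F x)).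
Proof.
move=> oU uF sF.
apply: (@smooth_mx_on_eq _ _ _ (fun x => (\det (F x))^-1 *: \adj (F x))) => //.
  by move=> x Ux; rewrite /invmx uF.
apply: smooth_mx_onZ => //.
  apply: smooth_onV => //; last exact: smooth_on_det.
  by move=> x /uF; rewrite unitmxE unitfE.
move=> i j; under eq_fun do rewrite mxE.
apply: smooth_onM => //; first exact: smooth_on_cst.
apply: smooth_on_det => // k l; under eq_fun do rewrite !mxE.
exact: sF.
Qed.

Lemma smooth_on_inner U (G : 'cV[R]_n -> 'M[R]_n) (V W : 'cV[R]_n -> 'cV[R]_n) :
  open U -> smooth_mx_on U G -> smooth_mx_on U V -> smooth_mx_on U W ->
  smooth_on U (fun x => inner (G x) (V x) (W x)).
Proof.
move=> oU sG sV sW; apply: (smooth_mx_onM oU _ sW 0 0).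
by apply: smooth_mx_onM => //; exact: smooth_mx_on_tr.
Qed.

End SmoothMx.

Section Leibniz.
Context {R : realType} {V : normedModType R}.

Lemma derive_mulmx a b c (F : V -> 'M[R]_(a, b)) (G : V -> 'M[R]_(b, c)) x v :
  derivable F x v -> derivable G x v ->
  'D_v (fun y => F y *m G y) x = 'D_v F x *m G x + F x *m 'D_v G x.
Proof.
move=> dF dG; have [dF' dG'] := ((derivable_mxP _ _ _).1 dF, (derivable_mxP _ _ _).1 dG).
have E i j : (fun y => (F y *m G y) i j) = \sum_(k < b) (fun y => F y i k * G y k j).
  by apply/funext => y; rewrite mxE fct_sumE.
have dFG : derivable (fun y => F y *m G y) x v.
  by apply/derivable_mxP => i j; rewrite E; apply: derivable_sum => k; exact: derivableM.
apply/matrixP => i j; rewrite derive_mx// mxE E derive_sum; last first.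
  by move=> k; exact: derivableM.
rewrite !mxE -big_split; apply: eq_bigr => k _ /=.
rewrite !derive_mx// !mxE.
have := deriveM (dF' i k) (dG' k j); rewrite /GRing.mul /= => ->.
by rewrite addrC; congr (_ + _); exact: mulrC.
Qed.

Lemma derive_trmx a b (F : V -> 'M[R]_(a, b)) x v : derivable F x v ->
  'D_v (fun y => (F y)^T) x = ('D_v F x)^T.
Proof.
move=> dF; have dF' := (derivable_mxP _ _ _).1 dF.
have dFT : derivable (fun y => (F y)^T) x v.
  by apply/derivable_mxP => i j; under eq_fun do rewrite mxE; exact: dF'.
apply/matrixP => i j; rewrite derive_mx// !mxE derive_mx// mxE.
by under eq_fun do rewrite mxE.
Qed.

Lemma derive_scalemx a b (f : V -> R) (F : V -> 'M[R]_(a, b)) x v :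
  derivable f x v -> derivable F x v ->
  'D_v (fun y => f y *: F y) x = 'D_v f x *: F x + f x *: 'D_v F x.
Proof.
move=> df dF; have dF' := (derivable_mxP _ _ _).1 dF.
have E i j : (fun y => (f y *: F y) i j) = f * (fun y => F y i j).
  by apply/funext => y; rewrite mxE.
have dfF : derivable (fun y => f y *: F y) x v.
  by apply/derivable_mxP => i j; rewrite E; exact: derivableM df (dF' i j).
apply/matrixP => i j; rewrite (derive_entry i j dfF) E.
have -> : ('D_v f x *: F x + f x *: 'D_v F x) i j =
    'D_v f x * F x i j + f x * 'D_v (fun y => F y i j) x.
  by rewrite mxE [X in X + _]mxE [X in _ + X]mxE (derive_entry i j dF).
apply: etrans (deriveM df (dF' i j)) _.
by rewrite addrC; congr (_ + _); exact: mulrC.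
Qed.

End Leibniz.

(** * Metrics, complex structures and the Levi-Civita connection *)

Section Inner.
Context {R : realType} {n : nat}.
Implicit Types (G A : 'M[R]_n) (u v w : 'cV[R]_n).

Lemma innerDl G u v w : inner G (u + v) w = inner G u w + inner G v w.
Proof. by rewrite /inner linearD/= !mulmxDl mxE. Qed.

Lemma innerDr G u v w : inner G w (u + v) = inner G w u + inner G w v.
Proof. by rewrite /inner mulmxDr mxE. Qed.

Lemma innerZl G (c : R) u v : inner G (c *: u) v = c * inner G u v.
Proof. by rewrite /inner linearZ/= -!scalemxAl mxE. Qed.

Lemma innerZr G (c : R) u v : inner G u (c *: v) = c * inner G u v.
Proof. by rewrite /inner -!scalemxAr mxE. Qed.

Lemma innerNl G u v : inner G (- u) v = - inner G u v.
Proof. by rewrite -scaleN1r innerZl mulN1r. Qed.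

Lemma innerNr G u v : inner G u (- v) = - inner G u v.
Proof. by rewrite -scaleN1r innerZr mulN1r. Qed.

Lemma inner0l G v : inner G 0 v = 0.
Proof. by rewrite -(scale0r 0) innerZl mul0r. Qed.

Lemma inner0r G v : inner G v 0 = 0.
Proof. by rewrite -(scale0r 0) innerZr mul0r. Qed.

Lemma innerC G u v : G^T = G -> inner G u v = inner G v u.
Proof.
move=> Gs; rewrite /inner (_ : v^T *m G *m u = (u^T *m G *m v)^T) ?mxE//.
by rewrite !trmx_mul trmxK Gs mulmxA.
Qed.

Lemma inner_nondeg G u : G \in unitmx ->
  (forall v, inner G v u = 0) -> u = 0.
Proof.
move=> uG u0; rewrite -[u]mul1mx -(mulVmx uG) -mulmxA.
suff -> : G *m u = 0 by rewrite mulmx0.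
apply/colP => i; have := u0 (evec i); rewrite /inner -mulmxA trmx_delta.
by rewrite -rowE !mxE.
Qed.

Lemma inner_sharp G (a : 'cV[R]_n -> R) w : G^T = G -> G \in unitmx ->
  (forall c u v, a (c *: u + v) = c * a u + a v) ->
  inner G (sharp G a) w = a w.
Proof.
move=> Gs uG al.
have a0 : a 0 = 0 by have := al (-1) 0 0; rewrite scaler0 addr0 mulN1r addNr.
have aZ c u : a (c *: u) = c * a u by rewrite -[_ *: _]addr0 al a0 addr0.
have aD u v : a (u + v) = a u + a v by rewrite -[u in LHS]scale1r al mul1r.
have as_ (f : 'I_n -> 'cV[R]_n) : a (\sum_k f k) = \sum_k a (f k).
  exact: (big_morph a aD a0).
rewrite /inner /sharp trmx_mul trmx_inv Gs mulmxKV// [in RHS](cV_sum_evec w).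
rewrite as_ mxE; apply: eq_bigr => k _.
by rewrite aZ !mxE mulrC.
Qed.

Lemma derive_inner (V : normedModType R) (G : V -> 'M[R]_n)
    (X Y : V -> 'cV[R]_n) (x v : V) :
  derivable G x v -> derivable X x v -> derivable Y x v ->
  'D_v (fun y => inner (G y) (X y) (Y y)) x =
  inner ('D_v G x) (X x) (Y x) + inner (G x) ('D_v X x) (Y x)
  + inner (G x) (X x) ('D_v Y x).
Proof.
move=> dG dX dY.
have dXT : derivable (fun y => (X y)^T) x v.
  apply/derivable_mxP => i j; under eq_fun do rewrite mxE.
  exact: (derivable_mxP _ _ _).1 dX _ _.
have dM a b c (F : V -> 'M[R]_(a, b)) (H : V -> 'M[R]_(b, c)) :
    derivable F x v -> derivable H x v -> derivable (fun y => F y *m H y) x v.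
  move=> /derivable_mxP dF /derivable_mxP dH; apply/derivable_mxP => i j.
  rewrite (_ : (fun y => _) = \sum_(k < b) (fun y => F y i k * H y k j)).
    by apply: derivable_sum => k; exact: derivableM.
  by apply/funext => y; rewrite mxE fct_sumE.
have d1 : derivable (fun y => (X y)^T *m G y) x v by exact: (dM).
have d2 : derivable (fun y => (X y)^T *m G y *m Y y) x v by exact: (dM).
apply: etrans (esym (derive_entry 0 0 d2)) _.
have E : 'D_v (fun y => (X y)^T *m G y *m Y y) x =
    (('D_v X x)^T *m G x + (X x)^T *m 'D_v G x) *m Y x
    + (X x)^T *m G x *m 'D_v Y x.
  apply: etrans (derive_mulmx d1 dY) _; congr (_ *m _ + _).
  apply: etrans (derive_mulmx dXT dG) _; congr (_ *m _ + _).
  exact: derive_trmx.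
apply: etrans (congr1 (fun Q : 'M[R]_1 => Q 0 0) E) _; rewrite mulmxDl /inner.
move: ('D_v X x) ('D_v G x) ('D_v Y x) => X' G' Y'.
by rewrite [LHS]mxE [X in X + _]mxE [X in X + _]addrC.
Qed.

End Inner.

(* [om u v w] stands for [g((nabla_u J) v, w)], written with the derivatives
   [gd] of the metric and [Jd] of the complex structure in a chart. *)
Section IntegrableTensor.
Variables (R : realType) (V : zmodType) (gm : V -> V -> R) (gd : V -> V -> V -> R).
Variables (J : V -> V) (Jd : V -> V -> V).

Definition koszul u v w := 2^-1 * (gd u v w + gd v u w - gd w u v).

Definition om u v w := gm (Jd u v) w + koszul u (J v) w + koszul u v (J w).

Hypothesis gmC : forall u v, gm u v = gm v u.
Hypothesis gdC : forall u v w, gd u v w = gd u w v.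
Hypothesis gmN : forall u v, gm (- u) v = - gm u v.
Hypothesis gdN1 : forall u v w, gd (- u) v w = - gd u v w.
Hypothesis gdN2 : forall u v w, gd u (- v) w = - gd u v w.
Hypothesis JJ : forall u, J (J u) = - u.
Hypothesis Jskew : forall u v, gm (J u) v = - gm u (J v).
Hypothesis Jd_skew : forall u v w,
  gm (Jd u v) w + gm v (Jd u w) + gd u (J v) w + gd u v (J w) = 0.
Hypothesis Jd_anti : forall u v, Jd u (J v) = - J (Jd u v).
Hypothesis nij0 : forall u v w,
  gm (Jd (J u) v) w - gm (Jd (J v) u) w
  + gm (J (Jd v u)) w - gm (J (Jd u v)) w = 0.

Lemma koszulC u v w : koszul u v w = koszul v u w.
Proof. by rewrite /koszul (addrC (gd u v w)) (gdC w u v). Qed.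

Lemma koszulD u v w : koszul u v w + koszul u w v = gd u v w.
Proof. by rewrite /koszul (gdC u w v) (gdC w u v) (gdC v u w); field. Qed.

Lemma koszulNr u v w : koszul u v (- w) = - koszul u v w.
Proof.
by rewrite /koszul (gdC u v) (gdC v u) !gdN1 !gdN2 (gdC u w) (gdC v w); ring.
Qed.

Lemma koszulNm u v w : koszul u (- v) w = - koszul u v w.
Proof. by rewrite /koszul gdN2 gdN1 (gdC w) gdN2 (gdC w v); ring. Qed.

Lemma om_skew u v w : om u w v = - om u v w.
Proof.
have := Jd_skew u v w; have := koszulD u (J v) w; have := koszulD u v (J w).
rewrite /om (gmC (Jd u w)); lra.
Qed.

Lemma om_J u v w : om u v (J w) = om u (J v) w.
Proof.
rewrite /om !JJ Jd_anti gmN koszulNr koszulNm.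
by have := Jskew (Jd u v) w; lra.
Qed.

Lemma om_Jl u v w : om (J u) v w = - om u v (J w).
Proof.
(* [E] is symmetric in its first two and skew in its last two arguments. *)
pose E u v w := om (J u) v w + om u v (J w).
have Esym a b c : E a b c = E b a c.
  have := nij0 a b c; rewrite /E /om !JJ !koszulNr !Jskew.
  rewrite (koszulC (J a) (J b)) (koszulC (J a) b) (koszulC a (J b)) (koszulC a b).
  lra.
have Eskew a b c : E a b c = - E a c b.
  have := om_skew (J a) b c; have := om_skew a (J b) c; have := om_J a b c.
  by rewrite /E; lra.
suff : E u v w = 0 by rewrite /E => /eqP; rewrite addr_eq0 => /eqP.
have := Esym u v w; have := Eskew u w v; have := Esym u w v.
have := Eskew w u v; have := Esym w v u; have := Eskew v w u; lra.
Qed.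

Definition dF u v w := om u v w + om v w u + om w u v.

Lemma dF_ext u v w : dF u v w =
  (gm (Jd u v) w + gd u (J v) w) - (gm (Jd v u) w + gd v (J u) w)
  + (gm (Jd w u) v + gd w (J u) v).
Proof.
have := koszulD u (J v) w; have := koszulD v (J w) u; have := koszulD w (J u) v.
have := Jd_skew v u w; have := gmC u (Jd v w).
have := gdC v (J w) u.
rewrite /dF /om (koszulC u w) (koszulC v u) (koszulC w v); lra.
Qed.

Lemma om_dF u v w : 2 * om u v w = dF u v w - dF u (J v) (J w).
Proof.
have JN a : J (- a) = - J a by rewrite -JJ JJ.
have omN a b c : om a b (- c) = - om a b c.
  by rewrite /om JN !koszulNr (gmC _ (- c)) gmN gmC; lra.
rewrite /dF !om_Jl -!om_J !JJ !omN; lra.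
Qed.

End IntegrableTensor.

(** * The null frame X, Y, AX, AY *)

(* Since [f ^+ 2 - 2 * p * f + 1 = 0], both [p] and [s = p - f] are rational in
   [f], so that [field] decides the identities between them. *)
Section NullPair.
Context {R : realType} {n : nat}.
Variables (G A B K : 'M[R]_n) (f q : R) (T : 'cV[R]_n).
Let p := (f ^+ 2 + 1) / (2 * f).
Let s := (1 - f ^+ 2) / (2 * f).
Hypothesis f0 : f != 0.
Hypothesis f21 : 1 - f ^+ 2 != 0.
Hypothesis Gs : G^T = G.
Hypothesis AA : A *m A = - 1%:M.
Hypothesis BB : B *m B = - 1%:M.
Hypothesis gA : forall u v, inner G (A *m u) (A *m v) = inner G u v.
Hypothesis gB : forall u v, inner G (B *m u) (B *m v) = inner G u v.
Hypothesis ABp : A *m B + B *m A = (2 * p)%:M.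
Hypothesis KE : K = (2 * s)^-1 *: (A *m B - B *m A).
Hypothesis gT : inner G T T = q.

Let s0 : s != 0.
Proof. by rewrite /s mulf_neq0// invr_eq0 mulf_neq0// pnatr_eq0. Qed.

Lemma AAv (v : 'cV[R]_n) : A *m (A *m v) = - v.
Proof. by rewrite mulmxA AA mulNmx mul1mx. Qed.

Lemma BBv (v : 'cV[R]_n) : B *m (B *m v) = - v.
Proof. by rewrite mulmxA BB mulNmx mul1mx. Qed.

Lemma ABv (v : 'cV[R]_n) : A *m (B *m v) = p *: v + s *: (K *m v).
Proof.
have -> : p *: v = 2^-1 *: ((A *m B + B *m A) *m v).
  by rewrite ABp mul_scalar_mx scalerA mulrA mulVf ?mul1r// pnatr_eq0.
rewrite KE -scalemxAl scalerA mulmxDl mulmxBl -!mulmxA.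
rewrite (_ : s * (2 * s)^-1 = 2^-1); last by field.
move: (A *m (B *m v)) (B *m (A *m v)) => a b.
by apply/colP => i; rewrite !mxE; field.
Qed.

Lemma BAv (v : 'cV[R]_n) : B *m (A *m v) = p *: v - s *: (K *m v).
Proof.
have -> : p *: v = 2^-1 *: ((A *m B + B *m A) *m v).
  by rewrite ABp mul_scalar_mx scalerA mulrA mulVf ?mul1r// pnatr_eq0.
rewrite KE -scalemxAl scalerA mulmxDl mulmxBl -!mulmxA.
rewrite (_ : s * (2 * s)^-1 = 2^-1); last by field.
move: (A *m (B *m v)) (B *m (A *m v)) => a b.
by apply/colP => i; rewrite !mxE; field.
Qed.

Let Kv (v : 'cV[R]_n) : K *m v = s^-1 *: (A *m (B *m v) - p *: v).
Proof. by rewrite ABv addrAC subrr add0r scalerA mulVf ?scale1r. Qed.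

Let Kv' (v : 'cV[R]_n) : K *m v = s^-1 *: (p *: v - B *m (A *m v)).
Proof. by rewrite BAv opprB addrC subrK scalerA mulVf ?scale1r. Qed.

Lemma AKv (v : 'cV[R]_n) : A *m (K *m v) = - s^-1 *: (B *m v + p *: (A *m v)).
Proof.
rewrite Kv -scalemxAr mulmxBr AAv -scalemxAr.
by rewrite scaleNr -scalerN opprD.
Qed.

Lemma KAv (v : 'cV[R]_n) : K *m (A *m v) = s^-1 *: (B *m v + p *: (A *m v)).
Proof. by rewrite Kv' AAv mulmxN opprK addrC. Qed.

Lemma BKv (v : 'cV[R]_n) : B *m (K *m v) = s^-1 *: (A *m v + p *: (B *m v)).
Proof. by rewrite Kv' -scalemxAr mulmxBr BBv -scalemxAr opprK addrC. Qed.

Lemma KBv (v : 'cV[R]_n) : K *m (B *m v) = - s^-1 *: (A *m v + p *: (B *m v)).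
Proof. by rewrite Kv BBv mulmxN scaleNr -scalerN opprD. Qed.

Lemma KKv (v : 'cV[R]_n) : K *m (K *m v) = v.
Proof.
rewrite [in X in _ *m X]Kv -scalemxAr mulmxBr -[K *m (p *: v)]scalemxAr.
rewrite KAv BBv ABv.
move: (K *m v) => a; apply/colP => i; rewrite !mxE /s /p; field.
by rewrite f0 f21.
Qed.

Lemma A_skew u v : inner G (A *m u) v = - inner G u (A *m v).
Proof. by rewrite -(gA u) AAv innerNr opprK. Qed.

Lemma B_skew u v : inner G (B *m u) v = - inner G u (B *m v).
Proof. by rewrite -(gB u) BBv innerNr opprK. Qed.

Lemma K_skew u v : inner G (K *m u) v = - inner G u (K *m v).
Proof.
rewrite Kv Kv' innerZl innerZr !innerDl !innerDr !innerNl !innerNr.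
by rewrite innerZl innerZr A_skew B_skew; field.
Qed.

Let X := (A + f *: B) *m T.
Let Y := T + K *m T.
Let XE : X = A *m T + f *: (B *m T).
Proof. by rewrite /X mulmxDl -scalemxAl. Qed.

Let skew0 (J : 'M[R]_n) : (forall u v, inner G (J *m u) v = - inner G u (J *m v)) ->
  inner G T (J *m T) = 0.
Proof. by move=> /(_ T T); rewrite (innerC _ _ Gs) => E; lra. Qed.

Let gTA : inner G T (A *m T) = 0. Proof. exact: skew0 A_skew. Qed.
Let gTB : inner G T (B *m T) = 0. Proof. exact: skew0 B_skew. Qed.
Let gTK : inner G T (K *m T) = 0. Proof. exact: skew0 K_skew. Qed.
Let gAT : inner G (A *m T) T = 0. Proof. by rewrite innerC. Qed.
Let gBT : inner G (B *m T) T = 0. Proof. by rewrite innerC. Qed.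
Let gKT : inner G (K *m T) T = 0. Proof. by rewrite innerC. Qed.
Let gAA : inner G (A *m T) (A *m T) = q. Proof. by rewrite gA. Qed.
Let gBB : inner G (B *m T) (B *m T) = q. Proof. by rewrite gB. Qed.
Let gKK : inner G (K *m T) (K *m T) = - q.
Proof. by rewrite K_skew KKv gT. Qed.
Let gAB : inner G (A *m T) (B *m T) = - p * q.
Proof. by rewrite A_skew ABv innerDr !innerZr gT gTK; ring. Qed.
Let gBA : inner G (B *m T) (A *m T) = - p * q. Proof. by rewrite innerC. Qed.
Let gKA : inner G (K *m T) (A *m T) = 0.
Proof. by rewrite K_skew KAv innerZr innerDr innerZr gTB gTA; ring. Qed.
Let gKB : inner G (K *m T) (B *m T) = 0.
Proof. by rewrite K_skew KBv innerZr innerDr innerZr gTB gTA; ring. Qed.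
Let gAK : inner G (A *m T) (K *m T) = 0. Proof. by rewrite innerC. Qed.
Let gBK : inner G (B *m T) (K *m T) = 0. Proof. by rewrite innerC. Qed.

Let gE := (gT, gTA, gTB, gTK, gAT, gBT, gKT, gAA, gBB, gKK, gAB, gBA, gKA, gKB, gAK, gBK).
Let iE := (@innerDl R n, @innerDr R n, @innerNl R n, @innerNr R n, @innerZl R n, @innerZr R n).

Let AY : A *m Y = A *m T - s^-1 *: (B *m T + p *: (A *m T)).
Proof. by rewrite /Y mulmxDr AKv scaleNr. Qed.

Let BY : B *m Y = B *m T + s^-1 *: (A *m T + p *: (B *m T)).
Proof. by rewrite /Y mulmxDr BKv. Qed.

Let AX : A *m X = - T + f *: (p *: T + s *: (K *m T)).
Proof. by rewrite XE mulmxDr AAv -scalemxAr ABv. Qed.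

Ltac pairing := rewrite ?AX ?AY ?BY ?XE /Y ?iE ?gE /p /s; field; rewrite ?f0 ?f21.

Lemma gXX : inner G X X = 0. Proof. by pairing. Qed.
Lemma gXY : inner G X Y = 0. Proof. by pairing. Qed.
Lemma gYY : inner G Y Y = 0. Proof. by pairing. Qed.
Lemma gTY : inner G T Y = q. Proof. by pairing. Qed.
Lemma gTAY : inner G T (A *m Y) = 0. Proof. by pairing. Qed.
Lemma gTBY : inner G T (B *m Y) = 0. Proof. by pairing. Qed.
Lemma gTAX : inner G T (A *m X) = - (1 - f ^+ 2) / 2 * q. Proof. by pairing. Qed.
Lemma gYAX : inner G Y (A *m X) = - (1 - f ^+ 2) * q. Proof. by pairing. Qed.
Lemma gXAX : inner G X (A *m X) = 0.  Proof. by pairing. Qed.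
Lemma gYAY : inner G Y (A *m Y) = 0.  Proof. by pairing. Qed.
Lemma gXAY : inner G X (A *m Y) = (1 - f ^+ 2) * q.  Proof. by pairing. Qed.

Lemma NX : (A + f *: B) *m X = 0.
Proof.
rewrite mulmxDl -scalemxAl AX XE mulmxDr -scalemxAr BAv BBv.
move: (K *m T) => a.
by apply/colP => i; rewrite !mxE /p /s; field; rewrite f0.
Qed.

Lemma NY : (A + f *: B) *m Y = 0.
Proof.
rewrite mulmxDl -scalemxAl AY BY; move: (A *m T) (B *m T) => a b.
by apply/colP => i; rewrite !mxE /p /s; field; rewrite f0.
Qed.

End NullPair.

Definition conn (R : realType) (n : nat) (G : 'cV[R]_n -> 'M[R]_n)
    (x v : 'cV[R]_n) (W : 'cV[R]_n -> 'cV[R]_n) : 'cV[R]_n :=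
  'D_v W x + christoffel G x v (W x).

Definition dmetric (R : realType) (n : nat) (G : 'cV[R]_n -> 'M[R]_n)
    (x u v w : 'cV[R]_n) : R := inner ('D_u G x) v w.

(* [ring] and [lra] compare atoms up to conversion, which would unfold the
   limits in derivatives. *)
Ltac generalize_pairings := repeat match goal with
  | |- context [inner ?a ?b ?c] => generalize (inner a b c)
  | |- context [dmetric ?a ?b ?c ?d] => generalize (dmetric a b c d)
  | |- context [koszul ?a ?b ?c ?d] => generalize (koszul a b c d)
  | |- context [om ?a ?b ?c ?d ?e ?f ?g] => generalize (om a b c d e f g)
  end.

Section LeviCivita.
Context {R : realType} {n : nat}.
Variables (U : set 'cV[R]_n) (G : 'cV[R]_n -> 'M[R]_n).
Hypothesis oU : open U.
Hypothesis sG : smooth_mx_on U G.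
Hypothesis Gs : forall x, U x -> (G x)^T = G x.
Hypothesis uG : forall x, U x -> G x \in unitmx.
Implicit Types (u v w : 'cV[R]_n) (V W : 'cV[R]_n -> 'cV[R]_n).

Lemma innerDmx (M N : 'M[R]_n) u v : inner (M + N) u v = inner M u v + inner N u v.
Proof. by rewrite /inner mulmxDr mulmxDl mxE. Qed.

Lemma innerZmx (c : R) (M : 'M[R]_n) u v : inner (c *: M) u v = c * inner M u v.
Proof. by rewrite /inner -scalemxAr -scalemxAl mxE. Qed.

Lemma near_on x (P : 'cV[R]_n -> Prop) : U x -> (forall y, U y -> P y) ->
  \forall y \near x, P y.
Proof.
move=> Ux UP; have nU : \forall y \near x, U y by apply: open_nbhs_nbhs.
by apply: filterS nU => y; exact: UP.
Qed.

Lemma smooth_mx_derivable a c (F : 'cV[R]_n -> 'M[R]_(a, c)) x v :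
  smooth_mx_on U F -> U x -> derivable F x v.
Proof.
by move=> sF Ux; apply: diff_derivable; exact: smooth_mx_differentiable Ux.
Qed.

Section Point.
Variable x : 'cV[R]_n.
Hypothesis Ux : U x.

Lemma derive_metric_cst u v w :
  'D_u (fun y => inner (G y) v w) x = dmetric G x u v w.
Proof.
rewrite (@derive_inner _ _ _ G (cst v) (cst w))//; last exact: smooth_mx_derivable.
by rewrite !derive_cst inner0l inner0r !addr0.
Qed.

Lemma dmetricC u v w : dmetric G x u v w = dmetric G x u w v.
Proof.
apply: innerC; rewrite -derive_trmx; last exact: smooth_mx_derivable.
by apply: near_eq_derive; apply: near_on.
Qed.

Lemma dmetricDl a b v w : dmetric G x (a + b) v w = dmetric G x a v w + dmetric G x b v w.
Proof.
by rewrite /dmetric derive_dirD ?innerDmx//; exact: smooth_mx_differentiable Ux.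
Qed.

Lemma dmetricZl (c : R) a v w : dmetric G x (c *: a) v w = c * dmetric G x a v w.
Proof.
by rewrite /dmetric derive_dirZ ?innerZmx//; exact: smooth_mx_differentiable Ux.
Qed.

Lemma dmetricN1 u v w : dmetric G x (- u) v w = - dmetric G x u v w.
Proof. by rewrite -scaleN1r dmetricZl mulN1r. Qed.

Lemma dmetricN2 u v w : dmetric G x u (- v) w = - dmetric G x u v w.
Proof. exact: innerNl. Qed.

Lemma dmetricDr u v a b : dmetric G x u v (a + b) = dmetric G x u v a + dmetric G x u v b.
Proof. exact: innerDr. Qed.

Lemma dmetricZr u v (c : R) a : dmetric G x u v (c *: a) = c * dmetric G x u v a.
Proof. exact: innerZr. Qed.

Lemma inner_christoffel u v w :
  inner (G x) (christoffel G x u v) w = koszul (dmetric G x) u v w.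
Proof.
rewrite /christoffel inner_sharp//; [|exact: Gs|exact: uG|].
  by rewrite !derive_metric_cst.
move=> c a b; rewrite !derive_metric_cst dmetricDl dmetricZl.
rewrite (dmetricDr u) (dmetricDr v) (dmetricZr u) (dmetricZr v).
by generalize_pairings; intros; ring.
Qed.

Lemma christoffelC u v : christoffel G x u v = christoffel G x v u.
Proof.
congr sharp; apply/funext => w; rewrite !derive_metric_cst.
by have := koszulC dmetricC u v w; rewrite /koszul.
Qed.

Lemma lie_conn V W : lie V W x = conn G x (V x) W - conn G x (W x) V.
Proof.
rewrite /lie /conn (christoffelC (W x)) opprD addrACA -[RHS]addrA.
by rewrite subrr addr0.
Qed.

Lemma derive_inner_conn v V W : derivable V x v -> derivable W x v ->
  'D_v (fun y => inner (G y) (V y) (W y)) x =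
  inner (G x) (conn G x v V) (W x) + inner (G x) (V x) (conn G x v W).
Proof.
move=> dV dW; rewrite derive_inner//; last exact: smooth_mx_derivable.
rewrite /conn innerDl innerDr inner_christoffel.
rewrite [X in _ = _ + (_ + X)]innerC; last exact: Gs.
rewrite inner_christoffel.
have := @koszulD _ _ (dmetric G x) dmetricC v (V x) (W x).
rewrite -/(dmetric G x v (V x) (W x)); generalize_pairings; intros; lra.
Qed.

Section Complex.
Variables (J : 'cV[R]_n -> 'M[R]_n) (th : 'cV[R]_n -> R).
Hypothesis sJ : smooth_mx_on U J.
Hypothesis JJ : forall y, U y -> J y *m J y = - 1%:M.
Hypothesis gJ : forall y u v, U y ->
  inner (G y) (J y *m u) (J y *m v) = inner (G y) u v.
Hypothesis nijJ : forall u v, nijenhuis J (fun=> u) (fun=> v) x = 0.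
Hypothesis dJ : forall v : 'I_3 -> 'cV[R]_n,
  ext_d (fundamental_form G J) x v =
  wedge1 (fun t => th (t ord0)) (fundamental_form G J x) v.

Let Jd u v : 'cV[R]_n := 'D_u J x *m v.

Definition omJ := om (inner (G x)) (dmetric G x) (mulmx (J x)) Jd.

Let JJv y v : U y -> J y *m (J y *m v) = - v.
Proof. by move=> Uy; rewrite mulmxA JJ// mulNmx mul1mx. Qed.

Let Jskew y u v : U y -> inner (G y) (J y *m u) v = - inner (G y) u (J y *m v).
Proof. by move=> Uy; rewrite -(gJ _ _ Uy) JJv// innerNl. Qed.

Let dJv u v : 'D_u (fun y => J y *m v) x = Jd u v.
Proof.
rewrite (@derive_mulmx _ _ _ _ _ J (cst v))//; last exact: smooth_mx_derivable.
by rewrite derive_cst mulmx0 addr0.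
Qed.

Let dbJv u v : derivable (fun y => J y *m v) x u.
Proof.
apply: smooth_mx_derivable => //; apply: smooth_mx_onM => //.
exact: smooth_mx_on_cst.
Qed.

Let derive_fundamental u v w : 'D_u (fun y => inner (G y) (J y *m v) w) x =
  inner (G x) (Jd u v) w + dmetric G x u (J x *m v) w.
Proof.
rewrite (@derive_inner _ _ _ G (fun y => J y *m v) (cst w))//;
  last exact: smooth_mx_derivable.
by rewrite derive_cst inner0r addr0 dJv addrC.
Qed.

Let Jd_skew u v w : inner (G x) (Jd u v) w + inner (G x) v (Jd u w)
  + dmetric G x u (J x *m v) w + dmetric G x u v (J x *m w) = 0.
Proof.
have : 'D_u (fun y => inner (G y) (J y *m v) w) x =
       'D_u (fun y => - inner (G y) (J y *m w) v) x.
  apply: near_eq_derive; apply: near_on => // y Uy; rewrite Jskew//.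
  by rewrite innerC//; exact: Gs.
rewrite deriveN; last first.
  have : smooth_on U (fun y => inner (G y) (J y *m w) v).
    apply: smooth_on_inner => //; last exact: smooth_mx_on_cst.
    by apply: smooth_mx_onM => //; exact: smooth_mx_on_cst.
  by move=> /smooth_differentiable h; apply: diff_derivable; exact: h.
rewrite !derive_fundamental (innerC _ v)// ?Gs// (dmetricC u v).
by generalize_pairings; intros; lra.
Qed.

Let Jd_anti u v : Jd u (J x *m v) = - (J x *m Jd u v).
Proof.
have : 'D_u (fun y => J y *m J y) x = 'D_u (fun y => - 1%:M) x.
  by apply: near_eq_derive; apply: near_on.
rewrite derive_cst derive_mulmx; try exact: smooth_mx_derivable.
move=> /eqP; rewrite addr_eq0 => /eqP E.
by rewrite /Jd !mulmxA E mulNmx.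
Qed.

Let nij0 u v w : inner (G x) (Jd (J x *m u) v) w - inner (G x) (Jd (J x *m v) u) w
  + inner (G x) (J x *m Jd v u) w - inner (G x) (J x *m Jd u v) w = 0.
Proof.
have L1 : lie (fun y => J y *m u) (fun y => J y *m v) x =
    Jd (J x *m u) v - Jd (J x *m v) u by rewrite /lie (dJv _ v) (dJv _ u).
have L2 : lie (fun y => J y *m u) (fun=> v) x = - Jd v u.
  by rewrite /lie derive_cst (dJv v u) sub0r.
have L3 : lie (fun=> u) (fun y => J y *m v) x = Jd u v.
  by rewrite /lie derive_cst (dJv u v) subr0.
have L4 : lie (fun=> u) (fun=> v) x = 0 by rewrite /lie !derive_cst subr0.
have := nijJ u v; rewrite /nijenhuis L1 L2 L3 L4.
move=> /(congr1 (fun z => inner (G x) z w)).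
by rewrite inner0l !innerDl mulmxN !innerNl inner0l !opprK oppr0 addr0.
Qed.

Let dF_th u v w : dF (inner (G x)) (dmetric G x) (mulmx (J x)) Jd u v w =
  th u * inner (G x) (J x *m v) w - th v * inner (G x) (J x *m u) w
  + th w * inner (G x) (J x *m u) v.
Proof.
have := dJ (fun l : 'I_3 => nth 0 [:: u; v; w] l).
rewrite /ext_d /wedge1 !big_ord_recl !big_ord0.
rewrite /fundamental_form /= !derive_fundamental.
rewrite !expr0 !expr1 !mul1r !addr0.
rewrite dF_ext; last exact: Jd_skew; last exact: dmetricC; last first.
  by move=> *; apply: innerC; exact: Gs.
by rewrite /bump /= !exprS !expr0; generalize_pairings; intros; lra.
Qed.

Lemma omJ_th u v w : 2 * omJ u v w =
  th (J x *m v) * inner (G x) u w - th v * inner (G x) (J x *m u) w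
  + th w * inner (G x) (J x *m u) v - th (J x *m w) * inner (G x) u v.
Proof.
have := @om_dF _ _ _ _ _ _ (fun a b => innerC a b (Gs Ux)) dmetricC
  (innerNl (G x)) dmetricN1 dmetricN2 (fun a => JJv a Ux)
  (fun a b => Jskew a b Ux) Jd_skew Jd_anti nij0 u v w.
rewrite -/omJ => ->; rewrite !dF_th !gJ//.
by generalize_pairings; intros; ring.
Qed.

Lemma conn_J u W w : derivable W x u ->
  inner (G x) (conn G x u (fun y => J y *m W y)) w =
  omJ u (W x) w + inner (G x) (J x *m conn G x u W) w.
Proof.
move=> dW; rewrite /conn derive_mulmx//; last exact: smooth_mx_derivable.
rewrite /omJ /om /Jd mulmxDr !innerDl !inner_christoffel Jskew//.
rewrite [inner _ (J x *m christoffel _ _ _ _) _]Jskew// inner_christoffel.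
by generalize_pairings; intros; lra.
Qed.

End Complex.
End Point.
End LeviCivita.

Section Frame.
Context {R : realType}.
Implicit Types (v w : 'cV[R]_4).

Lemma free4 (e1 e2 e3 e4 : 'cV[R]_4) :
  (forall a b c d, a *: e1 + b *: e2 + c *: e3 + d *: e4 = 0 ->
     [/\ a = 0, b = 0, c = 0 & d = 0]) -> free [:: e1; e2; e3; e4].
Proof.
move=> h; apply/(@freeP _ _ _ [tuple e1; e2; e3; e4]) => k.
rewrite !big_ord_recl big_ord0 /= addr0 !addrA => /h[k0 k1 k2 k3].
case=> [[|[|[|[|//]]]] i4].
- by rewrite -k0; congr k; exact: val_inj.
- by rewrite -k1; congr k; exact: val_inj.
- by rewrite -k2; congr k; exact: val_inj.
- by rewrite -k3; congr k; exact: val_inj.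
Qed.

Lemma free4_expand (e1 e2 e3 e4 : 'cV[R]_4) : free [:: e1; e2; e3; e4] ->
  forall v, exists a b c d, v = a *: e1 + b *: e2 + c *: e3 + d *: e4.
Proof.
move=> fr v; have : v \in span [:: e1; e2; e3; e4].
  suff -> : span [:: e1; e2; e3; e4] = fullv by exact: memvf.
  apply/eqP; rewrite eqEdim subvf dimvf /= (eqP fr).
  by rewrite /dim /=.
rewrite !span_cons span_nil addv0.
move=> /memv_addP[u1 /vlineP[a ->]] [v1 + ->].
move=> /memv_addP[u2 /vlineP[b ->]] [v2 + ->].
move=> /memv_addP[u3 /vlineP[c ->]] [v3 /vlineP[d ->] ->].
by exists a, b, c, d; rewrite !addrA.
Qed.

Variables (G : 'M[R]_4) (X Y A1 A2 : 'cV[R]_4) (c : R).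
Hypothesis Gs : G^T = G.
Hypothesis c0 : c != 0.
Hypothesis XX : inner G X X = 0.
Hypothesis XY : inner G X Y = 0.
Hypothesis YY : inner G Y Y = 0.
Hypothesis XA1 : inner G X A1 = 0.
Hypothesis YA1 : inner G Y A1 = c.
Hypothesis XA2 : inner G X A2 = - c.
Hypothesis YA2 : inner G Y A2 = 0.

Let cE (x : R) : c * x = 0 -> x = 0.
Proof. by move=> /eqP; rewrite mulf_eq0 (negbTE c0) => /eqP. Qed.

Let iE := (@innerDl R 4, @innerDr R 4, @innerZl R 4, @innerZr R 4, @inner0l R 4, @inner0r R 4).

Lemma null_frame_expand v : exists a b d e, v = a *: X + b *: Y + d *: A1 + e *: A2.
Proof.
apply: free4_expand; apply: free4 => a b d e E.
have e0 : e = 0.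
  by have /eqP := congr1 (inner G X) E; rewrite !iE XX XY XA1 XA2 => /eqP ?; apply: cE; lra.
have d0 : d = 0.
  have /eqP := congr1 (inner G Y) E.
  by rewrite !iE YY (innerC Y X Gs) XY YA1 YA2 => /eqP ?; apply: cE; lra.
move: E; rewrite e0 d0 !scale0r !addr0 => E.
have := congr1 (inner G ^~ A1) E; rewrite !iE XA1 YA1 => E1.
have := congr1 (inner G ^~ A2) E; rewrite !iE XA2 YA2 => E2.
by split=> //; apply: cE; lra.
Qed.

Lemma perp_null_line v : inner G X v = 0 -> inner G Y v = 0 -> inner G v A2 = 0 ->
  exists b, v = b *: Y.
Proof.
move=> Xv Yv vA; have [a [b [d [e E]]]] := null_frame_expand v.
have e0 : e = 0.
  by move: Xv; rewrite E !iE XX XY XA1 XA2 => ?; apply: cE; lra.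
have d0 : d = 0.
  by move: Yv; rewrite E !iE YY (innerC Y X Gs) XY YA1 YA2 => ?; apply: cE; lra.
move: E vA; rewrite e0 d0 !scale0r !addr0 => E.
rewrite E !iE XA2 YA2 => h; have a0 : a = 0 by apply: cE; lra.
by exists b; rewrite a0 scale0r add0r.
Qed.

Lemma perp_null_plane v : inner G X v = 0 -> inner G Y v = 0 ->
  exists a b, v = a *: X + b *: Y.
Proof.
move=> Xv Yv; have [a [b [d [e E]]]] := null_frame_expand v.
have e0 : e = 0.
  by move: Xv; rewrite E !iE XX XY XA1 XA2 => ?; apply: cE; lra.
have d0 : d = 0.
  by move: Yv; rewrite E !iE YY (innerC Y X Gs) XY YA1 YA2 => ?; apply: cE; lra.
by exists a, b; rewrite E e0 d0 !scale0r !addr0.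
Qed.

(* [L1] and [L2] play the roles of [X, Y] and [Y, AY]. *)
Variables (L1 L2 : 'cV[R]_4).
Hypothesis L1Y : inner G Y L1 = 0.
Hypothesis L1X : inner G X L1 != 0.
Hypothesis L2Y : inner G Y L2 != 0.

Lemma null_plane_free a b : a *: X + b *: Y = 0 -> a = 0 /\ b = 0.
Proof.
move=> E.
have := congr1 (inner G ^~ A1) E; rewrite !iE XA1 YA1 => E1.
have := congr1 (inner G ^~ A2) E; rewrite !iE XA2 YA2 => E2.
by split; apply: cE; lra.
Qed.

Lemma flag4_free : free [:: X; Y; L1; L2].
Proof.
apply: free4 => a b d e E.
have e0 : e = 0.
  have := congr1 (inner G Y) E; rewrite !iE YY (innerC Y X Gs) XY L1Y.
  rewrite !mulr0 !add0r => /eqP; rewrite mulf_eq0 (negbTE L2Y) orbF.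
  by move=> /eqP.
move: E; rewrite e0 scale0r addr0 => E.
have d0 : d = 0.
  have := congr1 (inner G X) E; rewrite !iE XX XY.
  by rewrite !mulr0 !add0r => /eqP; rewrite mulf_eq0 (negbTE L1X) orbF => /eqP.
by move: E; rewrite d0 scale0r addr0 => /null_plane_free[].
Qed.

Lemma flag3_span v : inner G Y v = 0 -> exists a b d, v = a *: X + b *: Y + d *: L1.
Proof.
move=> Yv; pose d := inner G X v / inner G X L1.
have [||a [b E]] := @perp_null_plane (v - d *: L1).
- by rewrite innerDr innerNr innerZr /d divfK// subrr.
- by rewrite innerDr innerNr innerZr Yv L1Y mulr0 subrr.
by exists a, b, d; rewrite -E subrK.
Qed.

End Frame.

Section ConnLinear.
Context {R : realType} {n : nat}.
Variables (U : set 'cV[R]_n) (G : 'cV[R]_n -> 'M[R]_n).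
Hypothesis oU : open U.
Hypothesis sG : smooth_mx_on U G.
Hypothesis Gs : forall x, U x -> (G x)^T = G x.
Hypothesis uG : forall x, U x -> G x \in unitmx.
Variable x : 'cV[R]_n.
Hypothesis Ux : U x.
Implicit Types (u v w : 'cV[R]_n) (V W : 'cV[R]_n -> 'cV[R]_n).

Lemma christoffelDr u v w :
  christoffel G x u (v + w) = christoffel G x u v + christoffel G x u w.
Proof.
apply/eqP; rewrite -subr_eq0; apply/eqP; apply: (inner_nondeg (uG Ux)) => z.
rewrite (innerC _ _ (Gs Ux)) innerDl innerNl innerDl.
rewrite !(inner_christoffel oU sG Gs uG Ux) /koszul.
rewrite (dmetricDl oU sG Ux) (dmetricDr _ _ z).
rewrite (dmetricC oU sG Gs Ux u (v + w)) (dmetricDr _ _ u).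
rewrite !(dmetricC oU sG Gs Ux u z).
by generalize_pairings; intros; ring.
Qed.

Lemma christoffelZr u (c : R) v :
  christoffel G x u (c *: v) = c *: christoffel G x u v.
Proof.
apply/eqP; rewrite -subr_eq0; apply/eqP; apply: (inner_nondeg (uG Ux)) => z.
rewrite (innerC _ _ (Gs Ux)) innerDl innerNl innerZl.
rewrite !(inner_christoffel oU sG Gs uG Ux) /koszul.
rewrite (dmetricZl oU sG Ux) (dmetricZr _ _ z).
rewrite (dmetricC oU sG Gs Ux u (c *: v)) (dmetricZr _ _ u).
rewrite !(dmetricC oU sG Gs Ux u z).
by generalize_pairings; intros; ring.
Qed.

Lemma connD u V W : derivable V x u -> derivable W x u ->
  conn G x u (fun y => V y + W y) = conn G x u V + conn G x u W.
Proof.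
move=> dV dW; rewrite /conn christoffelDr addrACA; congr (_ + _).
exact: (deriveD dV dW).
Qed.

Lemma connZ u (f : 'cV[R]_n -> R) W : derivable f x u -> derivable W x u ->
  conn G x u (fun y => f y *: W y) = 'D_u f x *: W x + f x *: conn G x u W.
Proof.
by move=> df dW; rewrite /conn christoffelZr scalerDr addrA derive_scalemx.
Qed.

Lemma conn_near u V W : (\forall y \near x, V y = W y) ->
  conn G x u V = conn G x u W.
Proof.
by move=> VW; rewrite /conn (near_eq_derive u VW) (nbhs_singleton VW).
Qed.

Lemma conn0 u : conn G x u (fun=> 0) = 0.
Proof.
rewrite /conn derive_cst add0r.
by have := christoffelZr u 0 0; rewrite !scale0r.
Qed.

End ConnLinear.

(* [th] is the Lee form of [A], and [- th] that of [B]. *)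
Record null_chart (R : realType) (U : set 'cV[R]_4)
    (G A B : 'cV[R]_4 -> 'M[R]_4) (th : 'cV[R]_4 -> 'cV[R]_4 -> R)
    (P : 'cV[R]_4 -> R) : Prop := NullChart {
  nc_open : open U;
  nc_smoothG : smooth_mx_on U G;
  nc_symG : forall x, U x -> (G x)^T = G x;
  nc_unitG : forall x, U x -> G x \in unitmx;
  nc_smoothA : smooth_mx_on U A;
  nc_smoothB : smooth_mx_on U B;
  nc_AA : forall x, U x -> A x *m A x = - 1%:M;
  nc_BB : forall x, U x -> B x *m B x = - 1%:M;
  nc_compatA : forall x u v, U x ->
    inner (G x) (A x *m u) (A x *m v) = inner (G x) u v;
  nc_compatB : forall x u v, U x ->
    inner (G x) (B x *m u) (B x *m v) = inner (G x) u v;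
  nc_nijA : forall x u v, U x -> nijenhuis A (fun=> u) (fun=> v) x = 0;
  nc_nijB : forall x u v, U x -> nijenhuis B (fun=> u) (fun=> v) x = 0;
  nc_smooth_th : forall v, smooth_on U (th ^~ v);
  nc_linear_th : forall x c u v, U x -> th x (c *: u + v) = c * th x u + th x v;
  nc_LeeA : forall x v, U x -> ext_d (fundamental_form G A) x v =
    wedge1 (fun t => th x (t ord0)) (fundamental_form G A x) v;
  nc_LeeB : forall x v, U x -> ext_d (fundamental_form G B) x v =
    wedge1 (fun t => - th x (t ord0)) (fundamental_form G B x) v;
  nc_AB : forall x, U x -> A x *m B x + B x *m A x = (2 * P x)%:M;
  nc_P : forall x, U x -> 1 < `|P x|;
  nc_th : forall x, U x ->
    inner (G x) (sharp (G x) (th x)) (sharp (G x) (th x)) != 0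
}.

Section NullChart.
Context {R : realType}.
Variables (U : set 'cV[R]_4) (G A B : 'cV[R]_4 -> 'M[R]_4).
Variables (th : 'cV[R]_4 -> 'cV[R]_4 -> R) (P : 'cV[R]_4 -> R).

Definition lee_field y := sharp (G y) (th y).
Definition rootp y := Num.sqrt (P y ^+ 2 - 1).
Definition fp y := P y - rootp y.
Definition Kfield y := (2 * rootp y)^-1 *: (A y *m B y - B y *m A y).
Definition Xfield y := (A y + fp y *: B y) *m lee_field y.
Definition Yfield y := lee_field y + Kfield y *m lee_field y.

Hypothesis D : null_chart U G A B th P.

Local Notation T := lee_field.
Local Notation X := Xfield.
Local Notation Y := Yfield.
Local Notation f := fp.
Local Notation q y := (inner (G y) (T y) (T y)).
Local Notation tau y := (inner (G y) (T y) (A y *m X y)).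

Let oU := nc_open D.
Let sG := nc_smoothG D.
Let Gs := nc_symG D.
Let uG := nc_unitG D.
Let sA := nc_smoothA D.
Let sB := nc_smoothB D.
Let AA := nc_AA D.
Let BB := nc_BB D.
Let gA := nc_compatA D.
Let gB := nc_compatB D.

Lemma P2_gt0 y : U y -> 0 < P y ^+ 2 - 1.
Proof.
move=> /(nc_P D) P1; rewrite subr_gt0 -real_normK ?num_real//.
by rewrite exprn_egt1.
Qed.

Lemma rootp_gt0 y : U y -> 0 < rootp y.
Proof. by move=> Uy; rewrite sqrtr_gt0 P2_gt0. Qed.

Lemma rootp2 y : U y -> rootp y ^+ 2 = P y ^+ 2 - 1.
Proof. by move=> Uy; rewrite sqr_sqrtr// ltW// P2_gt0. Qed.

Lemma fp_neq0 y : U y -> f y != 0.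
Proof.
move=> Uy; have := rootp2 Uy; rewrite /f; move: (rootp y) (P y) => s p E.
apply/eqP => /subr0_eq sp; move: E; rewrite sp => E; lra.
Qed.

Lemma P_fp y : U y -> P y = (f y ^+ 2 + 1) / (2 * f y).
Proof.
move=> Uy; have f0 := fp_neq0 Uy; have := rootp2 Uy.
have f20 : 2 * f y != 0 by rewrite mulf_neq0// pnatr_eq0.
move=> E; apply: (mulIf f20); rewrite divfK// /f.
by rewrite sqrrB E; ring.
Qed.

Lemma rootp_fp y : U y -> rootp y = (1 - f y ^+ 2) / (2 * f y).
Proof.
move=> Uy; have f0 := fp_neq0 Uy; have := P_fp Uy.
have -> : rootp y = P y - f y by rewrite /f opprB addrC subrK.
by move=> ->; field.
Qed.

Lemma fp2_neq1 y : U y -> 1 - f y ^+ 2 != 0.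
Proof.
move=> Uy; have := rootp_gt0 Uy; rewrite rootp_fp//.
by apply: contraTneq => ->; rewrite mul0r ltxx.
Qed.

Lemma lee_fieldE y v : U y -> inner (G y) (T y) v = th y v.
Proof.
move=> Uy; apply: inner_sharp; [exact: Gs|exact: uG|].
by move=> c u w; exact: (nc_linear_th D).
Qed.

Lemma smooth_lee_field : smooth_mx_on U T.
Proof.
apply: smooth_mx_onM => //; first by apply: smooth_mx_on_inv => //.
by move=> i j; under eq_fun do rewrite mxE; exact: (nc_smooth_th D).
Qed.

Lemma smooth_P : smooth_on U P.
Proof.
apply: (@smooth_on_eq _ _ _ (fun y => 2^-1 * (A y *m B y + B y *m A y) 0 0)) => //.
  by move=> y Uy; rewrite (nc_AB D)// mxE eqxx mulr1n mulrA mulVf ?mul1r// pnatr_eq0.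
apply: smooth_onM => //; first exact: smooth_on_cst.
by have := smooth_mx_onD oU (smooth_mx_onM oU sA sB) (smooth_mx_onM oU sB sA); exact.
Qed.

Lemma smooth_rootp : smooth_on U rootp.
Proof.
apply: smooth_on_sqrt => //; first exact: P2_gt0.
apply: smooth_onD => //; last exact: smooth_on_cst.
by apply: smooth_onM => //; exact: smooth_P.
Qed.

Lemma smooth_fp : smooth_on U f.
Proof.
apply: smooth_onD => //; first exact: smooth_P.
by apply: smooth_onN => //; exact: smooth_rootp.
Qed.

Lemma smooth_Xfield : smooth_mx_on U X.
Proof.
apply: smooth_mx_onM => //; last exact: smooth_lee_field.
apply: smooth_mx_onD => //; apply: smooth_mx_onZ => //; exact: smooth_fp.
Qed.

Lemma smooth_Yfield : smooth_mx_on U Y.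
Proof.
have sT := smooth_lee_field.
apply: smooth_mx_onD => //; apply: smooth_mx_onM => //.
apply: smooth_mx_onZ => //.
  apply: smooth_onV => //.
    by move=> y Uy; rewrite mulf_neq0 ?pnatr_eq0// gt_eqF// rootp_gt0.
  by apply: smooth_onM => //; [exact: smooth_on_cst|exact: smooth_rootp].
by apply: smooth_mx_onB => //; exact: smooth_mx_onM.
Qed.

Lemma smooth_AY : smooth_mx_on U (fun y => A y *m Y y).
Proof. by apply: smooth_mx_onM => //; exact: smooth_Yfield. Qed.

Section Algebra.
Variable y : 'cV[R]_4.
Hypothesis Uy : U y.

Let AB : A y *m B y + B y *m A y =
  (2 * ((f y ^+ 2 + 1) / (2 * f y)))%:M.
Proof. by rewrite -P_fp//; exact: (nc_AB D). Qed.

Let KE : Kfield y =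
  (2 * ((1 - f y ^+ 2) / (2 * f y)))^-1 *: (A y *m B y - B y *m A y).
Proof. by rewrite -rootp_fp. Qed.

Let f0 := fp_neq0 Uy.
Let f21 := fp2_neq1 Uy.
Let gA' u v := @gA y u v Uy.
Let gB' u v := @gB y u v Uy.

Lemma cXX : inner (G y) (X y) (X y) = 0.
Proof. exact: (gXX f0 f21 (Gs Uy) (AA Uy) (BB Uy) gA' gB' AB KE erefl). Qed.

Lemma cXY : inner (G y) (X y) (Y y) = 0.
Proof. exact: (gXY (T y) f0 f21 (Gs Uy) (AA Uy) (BB Uy) gA' gB' AB KE). Qed.

Lemma cYY : inner (G y) (Y y) (Y y) = 0.
Proof. exact: (gYY f0 f21 (Gs Uy) (AA Uy) (BB Uy) gA' gB' AB KE erefl). Qed.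

Lemma cTY : inner (G y) (T y) (Y y) = q y.
Proof. exact: (gTY f0 f21 (Gs Uy) (AA Uy) (BB Uy) gA' gB' AB KE erefl). Qed.

Lemma cTAY : inner (G y) (T y) (A y *m Y y) = 0.
Proof. exact: (gTAY (T y) f0 f21 (Gs Uy) (AA Uy) (BB Uy) gA' gB' AB KE). Qed.

Lemma cTBY : inner (G y) (T y) (B y *m Y y) = 0.
Proof. exact: (gTBY (T y) f0 f21 (Gs Uy) (AA Uy) (BB Uy) gA' gB' AB KE). Qed.

Lemma cXAX : inner (G y) (X y) (A y *m X y) = 0.
Proof. exact: (gXAX (T y) f0 f21 (Gs Uy) (AA Uy) (BB Uy) gA' gB' AB KE). Qed.

Lemma cYAY : inner (G y) (Y y) (A y *m Y y) = 0.
Proof. exact: (gYAY (T y) f0 f21 (Gs Uy) (AA Uy) (BB Uy) gA' gB' AB KE). Qed.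

Lemma cTAX : tau y = - (1 - f y ^+ 2) / 2 * q y.
Proof. exact: (gTAX f0 f21 (Gs Uy) (AA Uy) (BB Uy) gA' gB' AB KE erefl). Qed.

Lemma tau_neq0 : tau y != 0.
Proof.
by rewrite cTAX !mulf_neq0 ?oppr_eq0 ?invr_eq0 ?pnatr_eq0//; exact: (nc_th D).
Qed.

Lemma cYAX : inner (G y) (Y y) (A y *m X y) = 2 * tau y.
Proof.
by rewrite cTAX (gYAX f0 f21 (Gs Uy) (AA Uy) (BB Uy) gA' gB' AB KE erefl); field.
Qed.

Lemma cXAY : inner (G y) (X y) (A y *m Y y) = - (2 * tau y).
Proof.
by rewrite cTAX (gXAY f0 f21 (Gs Uy) (AA Uy) (BB Uy) gA' gB' AB KE erefl); field.
Qed.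

Lemma cNX : A y *m X y = - f y *: (B y *m X y).
Proof.
have := NX (T y) f0 f21 (AA Uy) (BB Uy) AB KE.
by rewrite [in LHS]mulmxDl -scalemxAl => /eqP; rewrite addr_eq0 scaleNr => /eqP.
Qed.

Lemma cNY : A y *m Y y = - f y *: (B y *m Y y).
Proof.
have := NY (T y) f0 f21 (AA Uy) (BB Uy) AB KE.
by rewrite [in LHS]mulmxDl -scalemxAl => /eqP; rewrite addr_eq0 scaleNr => /eqP.
Qed.

Lemma cA_skew u v : inner (G y) (A y *m u) v = - inner (G y) u (A y *m v).
Proof. exact: A_skew (AA Uy) gA' _ _. Qed.

Lemma cB_skew u v : inner (G y) (B y *m u) v = - inner (G y) u (B y *m v).
Proof. exact: A_skew (BB Uy) gB' _ _. Qed.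

End Algebra.

End NullChart.

Lemma inner_comb (R : realType) (n : nat) (G : 'M[R]_n) (a b : R)
    (u v w z : 'cV[R]_n) :
  inner G (u + (a *: v + b *: w)) z =
  inner G u z + (a * inner G v z + b * inner G w z).
Proof. by rewrite !innerDl !innerZl. Qed.

Section NullChartConnection.
Context {R : realType}.
Variables (U : set 'cV[R]_4) (G A B : 'cV[R]_4 -> 'M[R]_4).
Variables (th : 'cV[R]_4 -> 'cV[R]_4 -> R) (P : 'cV[R]_4 -> R).
Hypothesis D : null_chart U G A B th P.
Variable x : 'cV[R]_4.
Hypothesis Ux : U x.

Local Notation T := (lee_field G th).
Local Notation X := (Xfield G A B th P).
Local Notation Y := (Yfield G A B th P).
Local Notation f := (fp P).
Local Notation q := (inner (G x) (T x) (T x)).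
Local Notation tau := (inner (G x) (T x) (A x *m X x)).

Let oU := nc_open D.
Let sG := nc_smoothG D.
Let Gs := nc_symG D.
Let uG := nc_unitG D.
Let sA := nc_smoothA D.
Let sB := nc_smoothB D.
Let sX := smooth_Xfield D.
Let sY := smooth_Yfield D.

Let der (W : 'cV[R]_4 -> 'cV[R]_4) (v : 'cV[R]_4) : smooth_mx_on U W -> derivable W x v.
Proof. by move=> sW; exact: (smooth_mx_derivable oU sW Ux). Qed.

Let omA := omJ G x A.
Let omB := omJ G x B.

Let omA_th u v w : 2 * omA u v w =
  th x (A x *m v) * inner (G x) u w - th x v * inner (G x) (A x *m u) w
  + th x w * inner (G x) (A x *m u) v - th x (A x *m w) * inner (G x) u v.
Proof.
apply: (omJ_th oU sG Gs Ux sA (nc_AA D)) => [y a b|a b|a].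
- exact: (nc_compatA D).
- exact: (nc_nijA D).
- exact: (nc_LeeA D).
Qed.

Let omB_th u v w : 2 * omB u v w =
  - (th x (B x *m v) * inner (G x) u w - th x v * inner (G x) (B x *m u) w
  + th x w * inner (G x) (B x *m u) v - th x (B x *m w) * inner (G x) u v).
Proof.
rewrite (@omJ_th _ _ _ _ oU sG Gs x Ux B (fun v => - th x v) sB (nc_BB D)).
- by generalize_pairings; intros; ring.
- by move=> y a b; exact: (nc_compatB D).
- by move=> a b; exact: (nc_nijB D).
- by move=> a; exact: (nc_LeeB D).
Qed.

Let thE v : th x v = inner (G x) (T x) v.
Proof. by rewrite (lee_fieldE D). Qed.

(* Differentiate [(A + f B) Y = 0] and pair with [T]. *)
Lemma conn_Y_X v a b : v = a *: X x + b *: Y x ->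
  inner (G x) (conn G x v Y) (X x) = q * tau * a.
Proof.
move=> vE.
have sAY : smooth_mx_on U (fun y => A y *m Y y) by apply: smooth_mx_onM.
have sBY : smooth_mx_on U (fun y => B y *m Y y) by apply: smooth_mx_onM.
have sf := smooth_fp D.
have sfBY : smooth_mx_on U (fun y => f y *: (B y *m Y y)) by apply: smooth_mx_onZ.
have df : derivable f x v.
  by apply: diff_derivable; exact: smooth_differentiable oU sf Ux.
have c0 : conn G x v (fun y => A y *m Y y + f y *: (B y *m Y y)) = 0.
  rewrite -[RHS](conn0 oU sG Gs uG Ux v); apply: conn_near.
  apply: (near_on oU Ux) => y Uy.
  by rewrite (cNY D Uy) scaleNr addNr.
have := congr1 (fun z => inner (G x) z (T x)) c0.
rewrite inner0l (connD oU sG Gs uG Ux (der sAY) (der sfBY)) (connZ oU sG Gs uG Ux df (der sBY)).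
rewrite inner_comb => E0.
have dYv : derivable Y x v by exact: der sY.
have EA := conn_J oU sG Gs uG Ux sA (nc_AA D) (nc_compatA D) (T x) dYv.
have EB := congr1 ( *%R (f x))
  (conn_J oU sG Gs uG Ux sB (nc_BB D) (nc_compatB D) (T x) dYv).
have SA := cA_skew D Ux (conn G x v Y) (T x).
have SB := congr1 ( *%R (f x)) (cB_skew D Ux (conn G x v Y) (T x)).
have tBY : 'D_v f x * inner (G x) (B x *m Y x) (T x) = 0.
  by rewrite (innerC _ _ (Gs Ux)) (cTBY D Ux) mulr0.
have cX : inner (G x) (conn G x v Y) (X x) =
    inner (G x) (conn G x v Y) (A x *m T x)
    + f x * inner (G x) (conn G x v Y) (B x *m T x).
  by rewrite {1}/Xfield mulmxDl -scalemxAl; move: (conn _ _ _ _) => c; rewrite innerDr innerZr.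
have gAv : inner (G x) (A x *m v) (Y x) = 2 * (a * tau).
  rewrite vE mulmxDr -!scalemxAr innerDl !innerZl.
  rewrite (innerC _ (Y x) (Gs Ux)) (cYAX D Ux) (innerC _ (Y x) (Gs Ux)) (cYAY D Ux).
  by rewrite mulr0 addr0 mulrCA.
have tAv : inner (G x) (T x) (A x *m v) = a * tau.
  by rewrite vE mulmxDr -!scalemxAr innerDr !innerZr (cTAY D Ux) mulr0 addr0.
have Avf : A x *m v = - f x *: (B x *m v).
  rewrite vE !mulmxDr -!scalemxAr scalerDr (cNX D Ux) (cNY D Ux).
  by rewrite !scalerA ![_ * - f x]mulrC.
have vY : inner (G x) v (Y x) = 0.
  by rewrite vE innerDl !innerZl (cXY D Ux) (cYY D Ux) !mulr0 addr0.
have A2 := omA_th v (Y x) (T x).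
have B2 := omB_th v (Y x) (T x).
rewrite !thE (cTAY D Ux) (cTY D Ux) gAv vY (innerC (A x *m v) (T x) (Gs Ux)) tAv in A2.
rewrite !thE (cTBY D Ux) (cTY D Ux) vY in B2.
have gBv : f x * inner (G x) (B x *m v) (Y x) = - (2 * (a * tau)).
  by rewrite -gAv Avf innerZl mulNr opprK.
have tBv : f x * inner (G x) (B x *m v) (T x) = - (a * tau).
  by rewrite -tAv Avf innerZr mulNr opprK (innerC _ (T x) (Gs Ux)).
have fB : f x * (2 * omB v (Y x) (T x)) = q * (a * tau).
  rewrite B2; transitivity (q * (f x * inner (G x) (B x *m v) (T x))
     - q * (f x * inner (G x) (B x *m v) (Y x))).
    by generalize_pairings; move: (f x); intros; ring.
  by rewrite gBv tBv; generalize_pairings; intros; ring.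
move: A2 fB cX tBY SB SA EB EA E0; rewrite /omA /omB /=.
move: ('D_v f x) => df0.
generalize_pairings; move: (omJ G x A v (Y x) (T x)) (omJ G x B v (Y x) (T x)) (f x).
by intros; lra.
Qed.

End NullChartConnection.

Lemma inner_combr (R : realType) (n : nat) (G : 'M[R]_n) (a b : R)
    (u v z : 'cV[R]_n) :
  inner G z (a *: u + b *: v) = a * inner G z u + b * inner G z v.
Proof. by rewrite innerDr !innerZr. Qed.

Lemma innerBl (R : realType) (n : nat) (G : 'M[R]_n) (u v z : 'cV[R]_n) :
  inner G (u - v) z = inner G u z - inner G v z.
Proof. by rewrite innerDl innerNl. Qed.

Definition plane (R : realType) (n : nat) (X Y : 'cV[R]_n -> 'cV[R]_n)
    (x : 'cV[R]_n) : set 'cV[R]_n :=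
  [set v | exists c1 c2 : R, v = c1 *: X x + c2 *: Y x].

Section NullChartBrackets.
Context {R : realType}.
Variables (U : set 'cV[R]_4) (G A B : 'cV[R]_4 -> 'M[R]_4).
Variables (th : 'cV[R]_4 -> 'cV[R]_4 -> R) (P : 'cV[R]_4 -> R).
Hypothesis D : null_chart U G A B th P.
Variable x : 'cV[R]_4.
Hypothesis Ux : U x.

Local Notation T := (lee_field G th).
Local Notation X := (Xfield G A B th P).
Local Notation Y := (Yfield G A B th P).
Local Notation q y := (inner (G y) (T y) (T y)).
Local Notation tau := (inner (G x) (T x) (A x *m X x)).

Let oU := nc_open D.
Let sG := nc_smoothG D.
Let Gs := nc_symG D.
Let uG := nc_unitG D.
Let sX := smooth_Xfield D.
Let sY := smooth_Yfield D.
Let sAY := smooth_AY D.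
Let sT := smooth_lee_field D.

Definition Zfield y := (q y)^-1 *: T y.

Lemma smooth_Zfield : smooth_mx_on U Zfield.
Proof.
apply: smooth_mx_onZ => //; apply: smooth_onV => //; first exact: (nc_th D).
exact: smooth_on_inner.
Qed.

Lemma conn_orth (O : set 'cV[R]_4) (V W : 'cV[R]_4 -> 'cV[R]_4) v (k : R) :
  open O -> O x -> smooth_mx_on O V -> smooth_mx_on O W ->
  (forall y, O y -> inner (G y) (V y) (W y) = k) ->
  inner (G x) (conn G x v V) (W x) = - inner (G x) (conn G x v W) (V x).
Proof.
move=> oO Ox sV sW VW.
have dV : derivable V x v by exact: (smooth_mx_derivable oO sV Ox).
have dW : derivable W x v by exact: (smooth_mx_derivable oO sW Ox).
have E := derive_inner_conn oU sG Gs uG Ux dV dW.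
have E0 : 'D_v (fun y => inner (G y) (V y) (W y)) x = 0.
  rewrite -(derive_cst k x v); apply: near_eq_derive.
  exact: (near_on oO Ox).
move: E; rewrite E0 (innerC (V x) _ (Gs Ux)).
by generalize_pairings; intros; lra.
Qed.

Lemma lie_inner V W z : inner (G x) (lie V W x) z =
  inner (G x) (conn G x (V x) W) z - inner (G x) (conn G x (W x) V) z.
Proof. by rewrite (lie_conn oU sG Gs Ux) innerBl. Qed.

Lemma conn_Y_Y v : inner (G x) (conn G x v Y) (Y x) = 0.
Proof.
have := conn_orth v oU Ux sY sY (cYY D); generalize_pairings; intros; lra.
Qed.

Lemma conn_Y_plane v w a b c e : v = a *: X x + b *: Y x ->
  w = c *: X x + e *: Y x ->
  inner (G x) (conn G x v Y) w = q x * tau * a * c.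
Proof.
move=> vE ->; rewrite inner_combr conn_Y_Y mulr0 addr0.
by rewrite (conn_Y_X D Ux vE) mulrC.
Qed.

Lemma plane_perp_Y y v : U y -> plane X Y y v -> inner (G y) v (Y y) = 0.
Proof.
move=> Uy [a [b ->]]; rewrite (innerC _ (Y y) (Gs Uy)) inner_combr.
by rewrite (innerC _ (X y) (Gs Uy)) (cXY D Uy) (cYY D Uy) !mulr0 addr0.
Qed.

Lemma lie_plane_Y (O : set 'cV[R]_4) V W : open O -> O x -> O `<=` U ->
  smooth_mx_on O V -> smooth_mx_on O W ->
  (forall y, O y -> plane X Y y (V y)) -> (forall y, O y -> plane X Y y (W y)) ->
  inner (G x) (lie V W x) (Y x) = 0.
Proof.
move=> oO Ox OU sV sW DV DW; have sYO := smooth_mx_on_sub OU sY.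
have [a [b VE]] := DV x Ox; have [c [e WE]] := DW x Ox.
have E0 := lie_inner V W (Y x).
have E1 := conn_orth (V x) oO Ox sW sYO (fun y Oy => plane_perp_Y (OU y Oy) (DW y Oy)).
have E2 := conn_orth (W x) oO Ox sV sYO (fun y Oy => plane_perp_Y (OU y Oy) (DV y Oy)).
have E3 := conn_Y_plane VE WE; have E4 := conn_Y_plane WE VE.
by move: E0 E1 E2 E3 E4; generalize_pairings; intros; lra.
Qed.

Lemma lie_XY_X : inner (G x) (lie X Y x) (X x) = q x * tau.
Proof.
have XE : X x = 1 *: X x + 0 *: Y x by rewrite scale1r scale0r addr0.
have E0 := lie_inner X Y (X x); have E1 := conn_Y_X D Ux XE.
have E2 := conn_orth (Y x) oU Ux sX sX (cXX D).
by move: E0 E1 E2; generalize_pairings; intros; lra.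
Qed.

Lemma lie_XY_X_neq0 : inner (G x) (lie X Y x) (X x) != 0.
Proof. by rewrite lie_XY_X mulf_neq0 ?(tau_neq0 D)//; exact: (nc_th D). Qed.

Lemma lie_Y_AY : inner (G x) (lie Y (fun y => A y *m Y y) x) (Y x) =
  - inner (G x) (conn G x (Y x) Y) (A x *m Y x).
Proof.
have h y (Uy : U y) : inner (G y) (A y *m Y y) (Y y) = 0.
  by rewrite (innerC _ (Y y) (Gs Uy)) (cYAY D Uy).
have E0 := lie_inner Y (fun y => A y *m Y y) (Y x).
have E1 := conn_orth (Y x) oU Ux sAY sY h; have E2 := conn_Y_Y (A x *m Y x).
by move: E0 E1 E2; generalize_pairings; intros; lra.
Qed.

Lemma conn_YY_geodesic : inner (G x) (lie Y (fun y => A y *m Y y) x) (Y x) = 0 ->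
  conn G x (Y x) Y = (- inner (G x) (lie Y Zfield x) (Y x)) *: Y x.
Proof.
move=> h0; have h : inner (G x) (conn G x (Y x) Y) (A x *m Y x) = 0.
  by have E := lie_Y_AY; move: h0 E; generalize_pairings; intros; lra.
have YE : Y x = 0 *: X x + 1 *: Y x by rewrite scale1r scale0r add0r.
have cX : inner (G x) (X x) (conn G x (Y x) Y) = 0.
  by rewrite (innerC _ _ (Gs Ux)) (conn_Y_X D Ux YE) mulr0.
have cY : inner (G x) (Y x) (conn G x (Y x) Y) = 0.
  by rewrite (innerC _ _ (Gs Ux)) conn_Y_Y.
have tau20 : 2 * tau != 0 by rewrite mulf_neq0 ?pnatr_eq0// (tau_neq0 D).
have [b bE] := perp_null_line (Gs Ux) tau20 (cXX D Ux) (cXY D Ux) (cYY D Ux)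
  (cXAX D Ux) (cYAX D Ux) (cXAY D Ux) (cYAY D Ux) cX cY h.
have ZY y (Uy : U y) : inner (G y) (Zfield y) (Y y) = 1.
  by rewrite /Zfield innerZl (cTY D Uy) mulVf//; exact: (nc_th D).
have E0 := lie_inner Y Zfield (Y x).
have E1 := conn_orth (Y x) oU Ux smooth_Zfield sY ZY.
have E2 := conn_Y_Y (Zfield x).
have E3 : inner (G x) (conn G x (Y x) Y) (Zfield x) = b.
  by rewrite bE innerZl (innerC _ _ (Gs Ux)) ZY// mulr1.
have -> : - inner (G x) (lie Y Zfield x) (Y x) = b.
  by move: E0 E1 E2 E3; generalize_pairings; intros; lra.
exact: bE.
Qed.

End NullChartBrackets.

(** * Covariance under changes of charts *)

Section ChangeOfVariables.
Context {R : realType} {n : nat}.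
Variables (O : set 'cV[R]_n) (tau : 'cV[R]_n -> 'cV[R]_n).
Hypothesis oO : open O.
Hypothesis st : smooth_mx_on O tau.
Implicit Types (x v w : 'cV[R]_n) (V W : 'cV[R]_n -> 'cV[R]_n).

Definition jac x : 'M[R]_n := \matrix_(a, b) 'D_(evec b) (fun y => tau y a 0) x.

Lemma derive_jac x v : O x -> 'D_v tau x = jac x *m v.
Proof.
move=> Ox; apply/colP => a; rewrite derive_entry; last first.
  by apply: diff_derivable; exact: smooth_mx_differentiable Ox.
rewrite derive_partials; last exact: smooth_differentiable Ox.
by rewrite mxE; apply: eq_bigr => b _; rewrite mxE mulrC.
Qed.

Lemma smooth_jac : smooth_mx_on O jac.
Proof.
by move=> a b; under eq_fun do rewrite mxE; exact: smooth_on_partial.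
Qed.

Lemma derive_comp_var (F : 'cV[R]_n -> 'cV[R]_n) x v : O x ->
  differentiable F (tau x) ->
  'D_v (fun y => F (tau y)) x = 'D_('D_v tau x) F (tau x).
Proof.
move=> Ox dF; have dt := smooth_mx_differentiable oO st Ox.
rewrite (deriveE v (differentiable_comp dt dF)) diff_comp//= !deriveE//.
Qed.

Lemma derive_jacC x v w : O x -> 'D_v jac x *m w = 'D_w jac x *m v.
Proof.
move=> Ox; have dj u : derivable jac x u.
  by apply: diff_derivable; exact: smooth_mx_differentiable smooth_jac Ox.
have E u z a : ('D_u jac x *m z) a 0 = \sum_b \sum_c (u c 0 * z b 0) *
    'D_(evec c) (fun y => 'D_(evec b) (fun y => tau y a 0) y) x.
  rewrite mxE; apply: eq_bigr => b _; rewrite derive_entry//.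
  have -> : (fun y => jac y a b) = (fun y => 'D_(evec b) (fun y => tau y a 0) y).
    by apply/funext => y; rewrite mxE.
  rewrite derive_partials; last first.
    by apply: smooth_differentiable oO _ Ox; exact: smooth_on_partial.
  by rewrite big_distrl; apply: eq_bigr => c _; rewrite mulrAC.
apply/colP => a; rewrite !E exchange_big; apply: eq_bigr => b _.
apply: eq_bigr => c _; rewrite (mulrC (w c 0)).
by rewrite (clairaut c b oO (st a 0 2) Ox).
Qed.

Lemma lie_push V W V' W' x (O' : set 'cV[R]_n) : O x ->
  smooth_mx_on O V -> smooth_mx_on O W ->
  open O' -> O' (tau x) -> smooth_mx_on O' V' -> smooth_mx_on O' W' ->
  (forall y, O y -> V' (tau y) = 'D_(V y) tau y) ->
  (forall y, O y -> W' (tau y) = 'D_(W y) tau y) ->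
  lie V' W' (tau x) = 'D_(lie V W x) tau x.
Proof.
move=> Ox sV sW oO' Ox' sV' sW' VV WW.
have dV u : derivable V x u.
  by apply: diff_derivable; exact: smooth_mx_differentiable sV Ox.
have dW u : derivable W x u.
  by apply: diff_derivable; exact: smooth_mx_differentiable sW Ox.
have dj u : derivable jac x u.
  by apply: diff_derivable; exact: smooth_mx_differentiable smooth_jac Ox.
have key Z Z' u : (forall w, derivable Z x w) -> smooth_mx_on O' Z' ->
    (forall y, O y -> Z' (tau y) = 'D_(Z y) tau y) ->
    'D_('D_u tau x) Z' (tau x) = 'D_u jac x *m Z x + jac x *m 'D_u Z x.
  move=> dZ sZ' ZZ; rewrite -derive_comp_var//; last first.
    exact: smooth_mx_differentiable sZ' Ox'.
  rewrite -derive_mulmx//; apply: near_eq_derive.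
  by apply: (near_on oO Ox) => y Oy; rewrite ZZ// derive_jac.
have KW := key W W' (V x) dW sW' WW; have KV := key V V' (W x) dV sV' VV.
have -> : lie V' W' (tau x) =
    'D_('D_(V x) tau x) W' (tau x) - 'D_('D_(W x) tau x) V' (tau x).
  by rewrite /lie -(VV x Ox) -(WW x Ox).
rewrite (derive_jac (lie V W x) Ox).
have S := derive_jacC (V x) (W x) Ox.
apply: etrans (congr2 (fun u w => u - w) KW KV) _.
have alg (u w y z : 'cV[R]_n) : u = w -> (u + y) - (w + z) = y - z.
  by move=> ->; rewrite opprD addrACA subrr add0r.
apply: etrans (alg _ _ _ _ S) _.
exact: esym (mulmxBr _ _ _).
Qed.

End ChangeOfVariables.

Section Charts.
Context {R : realType} {n : nat} {M : manifold R n}.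
Implicit Types (i j : chart_ix M) (x v : 'cV[R]_n).

Lemma overlap_open i j : open (overlap i j).
Proof.
rewrite openE => x [ix jx]; rewrite /interior /=.
have n1 : \forall y \near x, chart_img i y.
  by apply: open_nbhs_nbhs; split => //; exact: chart_img_open.
have n2 : \forall y \near x, chart_dom j (chart_inv i y).
  apply: (chart_inv_continuous ix); apply: open_nbhs_nbhs.
  by split => //; exact: chart_dom_open.
exact: filterI n1 n2.
Qed.

Lemma transition_img i j x : overlap i j x -> chart_img j (transition i j x).
Proof. by move=> [_ jx]; exists (chart_inv i x). Qed.

Lemma transition_inv i j x : overlap i j x ->
  chart_inv j (transition i j x) = chart_inv i x.
Proof. by move=> [_ jx]; exact: chart_mapK. Qed.

Lemma chart_inv_dom i x : chart_img i x -> chart_dom i (chart_inv i x).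
Proof. by move=> [m im <-]; rewrite chart_mapK. Qed.

Lemma chart_invK i x : chart_img i x -> chart_map i (chart_inv i x) = x.
Proof. by move=> [m im <-]; rewrite chart_mapK. Qed.

Lemma transition_differentiable i j x : overlap i j x ->
  differentiable (transition i j) x.
Proof.
by apply: smooth_mx_differentiable; [exact: overlap_open|exact: transition_smooth].
Qed.

Lemma pushD i j x u v : overlap i j x ->
  push i j x (u + v) = push i j x u + push i j x v.
Proof. by move=> /transition_differentiable; exact: derive_dirD. Qed.

Lemma pushZ i j x (c : R) v : overlap i j x ->
  push i j x (c *: v) = c *: push i j x v.
Proof. by move=> /transition_differentiable; exact: derive_dirZ. Qed.

Lemma pushN i j x v : overlap i j x -> push i j x (- v) = - push i j x v.
Proof. by move=> /transition_differentiable; exact: derive_dirN. Qed.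

Lemma push_lie i j (V W : chart_ix M -> 'cV[R]_n -> 'cV[R]_n) x :
  (forall i, smooth_mx_on (chart_img i) (V i)) ->
  (forall i, smooth_mx_on (chart_img i) (W i)) ->
  (forall x, overlap i j x -> V j (transition i j x) = push i j x (V i x)) ->
  (forall x, overlap i j x -> W j (transition i j x) = push i j x (W i x)) ->
  overlap i j x ->
  lie (V j) (W j) (transition i j x) = push i j x (lie (V i) (W i) x).
Proof.
move=> sV sW VV WW ijx.
have sub : overlap i j `<=` chart_img i by move=> y [].
have oo : open (overlap i j) by exact: overlap_open.
have oj : open (chart_img j) by exact: chart_img_open.
have st : smooth_mx_on (overlap i j) (transition i j) by exact: transition_smooth.
exact: (lie_push oo st ijx (smooth_mx_on_sub sub (sV i))
  (smooth_mx_on_sub sub (sW i)) oj (transition_img ijx) (sV j) (sW j) VV WW).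
Qed.

End Charts.

(** * Growth of the distribution *)

Section Spans.
Context {R : realType} {n : nat}.
Implicit Types (S : set 'cV[R]_n).

Lemma lin_span_tuple r (b : r.-tuple 'cV[R]_n) S :
  (forall w, w \in b -> S w) -> (forall w, S w -> w \in span b) ->
  lin_span S = [set v | v \in span b].
Proof.
move=> bS Sb; apply/seteqP; split=> v /=; last by move=> vb; exists b.
move=> [s [sS]]; apply: subvP; apply/span_subvP => w /sS; exact: Sb.
Qed.

(* [D_V] of the coordinate vanishing at [x] turns [W x] itself into a bracket. *)
Lemma lie_localize (O : set 'cV[R]_n) (V W : 'cV[R]_n -> 'cV[R]_n) x :
  open O -> O x -> smooth_mx_on O V -> smooth_mx_on O W -> V x != 0 ->
  exists (c : R) (phi : 'cV[R]_n -> R), [/\ smooth_on O phi &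
    lie (fun y => c *: V y) (fun y => phi y *: W y) x = W x].
Proof.
move=> oO Ox sV sW V0.
have [k Vk] : exists k, V x k 0 != 0.
  apply/existsP; apply: contraNT V0; rewrite negb_exists => /forallP V0.
  by apply/eqP/colP => k; rewrite mxE; apply/eqP; rewrite -[_ == _]negbK V0.
have sc : smooth_on [set: 'cV[R]_n] (fun y : 'cV[R]_n => y k 0).
  have dk : forall j, 'D_(evec j) (fun y : 'cV[R]_n => y k 0) = cst ((k == j)%:R).
    move=> j; apply/funext => y; rewrite -derive_entry; last exact: derivable_id.
    by rewrite derive_id mxE eqxx andbT.
  have ck : forall y : 'cV[R]_n, {for y, continuous (fun y : 'cV[R]_n => y k 0)}.
    by move=> y; apply: differentiable_continuous; exact: differentiable_coord.
  case=> [|m]; (split; first by move=> y _; exact: ck) => // j.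
  split=> [y _|].
    by apply: diff_derivable; exact: differentiable_coord.
  by rewrite dk; exact: Ck_on_cst.
have {}sc : smooth_on O (fun y : 'cV[R]_n => y k 0) by exact: smooth_on_sub sc.
pose phi (y : 'cV[R]_n) := y k 0 - x k 0.
have sphi : smooth_on O phi.
  by apply: smooth_onD => //; exact: smooth_on_cst.
exists (V x k 0)^-1, phi; split=> //.
have phix : phi x = 0 by rewrite /phi subrr.
have dphi u : derivable phi x u.
  by apply: diff_derivable; exact: smooth_differentiable sphi Ox.
have Dphi u : 'D_u phi x = u k 0.
  have := @deriveB _ _ _ (fun y : 'cV[R]_n => y k 0) (cst (x k 0)) x u.
  rewrite derive_cst subr0 => E; apply: etrans (E _ _) _ => //.
    by apply: diff_derivable; exact: differentiable_coord.
  by rewrite -derive_entry ?derive_id//; exact: derivable_id.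
have dW u : derivable W x u.
  by apply: diff_derivable; exact: smooth_mx_differentiable sW Ox.
rewrite /lie derive_scalemx// phix !scale0r derive0 subr0 addr0 Dphi mxE.
by rewrite mulVf// scale1r.
Qed.

End Spans.

Section Flag.
Context {R : realType} {M : manifold R 4}.
Variables (i : chart_ix M) (G A B : 'cV[R]_4 -> 'M[R]_4).
Variables (th : 'cV[R]_4 -> 'cV[R]_4 -> R) (P : 'cV[R]_4 -> R).
Variable DD : chart_ix M -> 'cV[R]_4 -> set 'cV[R]_4.
Hypothesis D : null_chart (chart_img i) G A B th P.

Local Notation T := (lee_field G th).
Local Notation X := (Xfield G A B th P).
Local Notation Y := (Yfield G A B th P).
Local Notation tau x := (inner (G x) (T x) (A x *m X x)).
Local Notation U := (chart_img i).

Hypothesis DDE : forall y, DD i y = plane X Y y.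

Let oU := nc_open D.
Let Gs := nc_symG D.
Let sX := smooth_Xfield D.
Let sY := smooth_Yfield D.

Lemma plane_X y : plane X Y y (X y).
Proof. by exists 1, 0; rewrite scale1r scale0r addr0. Qed.

Lemma plane_Y y : plane X Y y (Y y).
Proof. by exists 0, 1; rewrite scale1r scale0r add0r. Qed.

Lemma planeZ y (c : R) v : plane X Y y v -> plane X Y y (c *: v).
Proof. by move=> [a [b ->]]; exists (c * a), (c * b); rewrite scalerDr !scalerA. Qed.

Lemma plane_section O (V : 'cV[R]_4 -> 'cV[R]_4) : smooth_mx_on O V ->
  (forall y, O y -> plane X Y y (V y)) -> smooth_section DD i O V.
Proof. by move=> sV VD; split=> // y Oy; rewrite DDE; exact: VD. Qed.

Section Point.
Variable x : 'cV[R]_4.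
Hypothesis Ux : U x.

Let L := lie X Y x.

Lemma tau20 : 2 * tau x != 0.
Proof. by rewrite mulf_neq0 ?pnatr_eq0// (tau_neq0 D). Qed.

Lemma inner_Y_L : inner (G x) (Y x) L = 0.
Proof.
rewrite (innerC _ _ (Gs Ux)).
apply: (lie_plane_Y D Ux oU Ux) => //.
- by move=> y _; exact: plane_X.
- by move=> y _; exact: plane_Y.
Qed.

Lemma inner_X_L : inner (G x) (X x) L != 0.
Proof. by rewrite (innerC _ _ (Gs Ux)); exact: (lie_XY_X_neq0 D Ux). Qed.

Lemma flag_free L2 : inner (G x) (Y x) L2 != 0 -> free [:: X x; Y x; L; L2].
Proof.
exact: (flag4_free (Gs Ux) tau20 (cXX D Ux) (cXY D Ux) (cYY D Ux) (cXAX D Ux)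
  (cYAX D Ux) (cXAY D Ux) (cYAY D Ux) inner_Y_L inner_X_L).
Qed.

Lemma flag_free4 : free [:: X x; Y x; L; A x *m X x].
Proof. by apply: flag_free; rewrite (cYAX D Ux) tau20. Qed.

Lemma X_neq0 : X x != 0.
Proof.
by apply: contraNneq tau20 => X0; rewrite X0 mulmx0 inner0r mulr0.
Qed.

Lemma rank2_plane : has_rank 2 (DD i x).
Proof.
exists [tuple X x; Y x]; split.
  have := flag_free4; rewrite -[[:: _, _ & _]]/([:: X x; Y x] ++ _).
  exact: catl_free.
rewrite DDE; apply/seteqP; split=> v /=.
  move=> [a [b ->]]; apply: memvD; apply: memvZ; apply: memv_span.
    by rewrite inE eqxx.
  by rewrite !inE eqxx orbT.
rewrite !span_cons span_nil addv0.
by move=> /memv_addP[u /vlineP[a ->]] [w /vlineP[b ->] ->]; exists a, b.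
Qed.

Lemma bracket_of_sections D1 D2 V W :
  smooth_section D1 i U V -> smooth_section D2 i U W ->
  [set w | exists O V W,
    [/\ open O /\ O x, O `<=` chart_img i, smooth_section D1 i O V,
        smooth_section D2 i O W & w = lie V W x]] (lie V W x).
Proof. by move=> sV sW; exists U, V, W; split=> //; exact: subset_refl. Qed.

Lemma bracket_localize (D2 : chart_ix M -> 'cV[R]_4 -> set 'cV[R]_4) W :
  smooth_section D2 i U W ->
  (forall y (c : R) v, U y -> D2 i y v -> D2 i y (c *: v)) ->
  [set w | exists O V W,
    [/\ open O /\ O x, O `<=` chart_img i, smooth_section DD i O V,
        smooth_section D2 i O W & w = lie V W x]] (W x).
Proof.
move=> [sW WD] D2Z.
have [c [phi [sphi E]]] := lie_localize oU Ux sX sW X_neq0.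
rewrite -E; apply: bracket_of_sections.
  apply: plane_section.
    by apply: smooth_mx_onZ => //; exact: smooth_on_cst.
  by move=> y Uy; apply: planeZ; exact: plane_X.
split; first exact: smooth_mx_onZ.
by move=> y Uy; apply: D2Z => //; exact: WD.
Qed.

Lemma bracket_plane_span :
  bracket DD DD i x = [set v | v \in span [tuple X x; Y x; L]].
Proof.
apply: lin_span_tuple => w.
  have DZ y (c : R) v : U y -> DD i y v -> DD i y (c *: v).
    by rewrite DDE => _; exact: planeZ.
  rewrite !inE => /or3P[]/eqP->.
  - apply: bracket_localize => //; apply: plane_section => // y _.
    exact: plane_X.
  - apply: bracket_localize => //; apply: plane_section => // y _.
    exact: plane_Y.
  - apply: bracket_of_sections; apply: plane_section => // y _.
      exact: plane_X.
    exact: plane_Y.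
case=> O [V [W [[oO Ox] OU [sV VD] [sW WD] ->]]].
have wY : inner (G x) (Y x) (lie V W x) = 0.
  rewrite (innerC _ _ (Gs Ux)).
  apply: (lie_plane_Y D Ux oO Ox OU sV sW) => y Oy; rewrite -DDE; [exact: VD|exact: WD].
have [a [b [d ->]]] := flag3_span (Gs Ux) tau20 (cXX D Ux) (cXY D Ux) (cYY D Ux)
  (cXAX D Ux) (cYAX D Ux) (cXAY D Ux) (cYAY D Ux) inner_Y_L inner_X_L wY.
apply: memvD; [apply: memvD|]; apply: memvZ; apply: memv_span; rewrite !inE eqxx ?orbT//.
Qed.

Lemma rank3_bracket : has_rank 3 (bracket DD DD i x).
Proof.
exists [tuple X x; Y x; L]; split; last exact: bracket_plane_span.
have := flag_free4; rewrite -[[:: _, _, _ & _]]/([:: X x; Y x; L] ++ _).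
exact: catl_free.
Qed.

Lemma bracket_planeE v : bracket DD DD i x v <-> inner (G x) (Y x) v = 0.
Proof.
rewrite bracket_plane_span /=; split.
  rewrite !span_cons span_nil addv0.
  move=> /memv_addP[_ /vlineP[a ->]] [w + ->].
  move=> /memv_addP[_ /vlineP[b ->]] [_ /vlineP[d ->] ->].
  rewrite !innerDr !innerZr inner_Y_L (cYY D Ux) (innerC _ (X x) (Gs Ux)) (cXY D Ux).
  by rewrite !mulr0 !addr0.
move=> wY.
have [a [b [d ->]]] := flag3_span (Gs Ux) tau20 (cXX D Ux) (cXY D Ux) (cYY D Ux)
  (cXAX D Ux) (cYAX D Ux) (cXAY D Ux) (cYAY D Ux) inner_Y_L inner_X_L wY.
apply: memvD; [apply: memvD|]; apply: memvZ; apply: memv_span; rewrite !inE eqxx ?orbT//.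
Qed.

End Point.

Lemma rank4_bracket x : U x ->
  inner (G x) (lie Y (fun y => A y *m Y y) x) (Y x) != 0 ->
  has_rank 4 (bracket DD (bracket DD DD) i x).
Proof.
move=> Ux h; set L2 := lie Y (fun y => A y *m Y y) x in h.
have fr : free [tuple X x; Y x; lie X Y x; L2].
  by apply: flag_free => //; rewrite (innerC _ _ (Gs Ux)).
exists [tuple X x; Y x; lie X Y x; L2]; split => //.
have DZ y (c : R) v : U y -> bracket DD DD i y v -> bracket DD DD i y (c *: v).
  by move=> Uy /(bracket_planeE Uy) E; apply/(bracket_planeE Uy); rewrite innerZr E mulr0.
apply: lin_span_tuple => w; last first.
  move=> _; suff -> : span [tuple X x; Y x; lie X Y x; L2] = fullv by exact: memvf.
  by apply/eqP; rewrite eqEdim subvf dimvf /= (eqP fr).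
rewrite !inE => /or4P[]/eqP->.
- apply: bracket_localize => //; split=> // y Uy; apply/bracket_planeE => //.
  by rewrite (innerC _ _ (Gs Uy)) (cXY D Uy).
- by apply: bracket_localize => //; split=> // y Uy; apply/bracket_planeE => //; exact: (cYY D Uy).
- apply: (@bracket_localize _ _ _ (lie X Y)) => //; split.
    by apply: smooth_mx_onB => //; exact: smooth_mx_on_derive.
  by move=> y Uy; apply/bracket_planeE => //; exact: inner_Y_L.
- apply: (@bracket_of_sections x Ux DD (bracket DD DD) Y (fun y => A y *m Y y)).
    by apply: plane_section => // y _; exact: plane_Y.
  split; first exact: (smooth_AY D).
  by move=> y Uy; apply/bracket_planeE => //; exact: (cYAY D Uy).
Qed.

End Flag.

Lemma inner_plane0 (R : realType) (n : nat) (G : 'M[R]_n) (u v : 'cV[R]_n)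
    (a b c d : R) :
  inner G u u = 0 -> inner G u v = 0 -> inner G v u = 0 -> inner G v v = 0 ->
  inner G (a *: u + b *: v) (c *: u + d *: v) = 0.
Proof.
move=> uu uv vu vv; rewrite innerDl !innerDr !innerZl !innerZr uu uv vu vv.
by rewrite !mulr0 !addr0.
Qed.

Section Covariance.
Context {R : realType} {M : manifold R 4}.
Variables (g A B : chart_ix M -> 'cV[R]_4 -> 'M[R]_4).
Variables (th : chart_ix M -> 'cV[R]_4 -> 'cV[R]_4 -> R) (p : M -> R).
Hypothesis NC : forall i,
  null_chart (chart_img i) (g i) (A i) (B i) (th i) (p \o chart_inv i).
Hypothesis cov_g : forall i j x u v, overlap i j x ->
  inner (g j (transition i j x)) (push i j x u) (push i j x v) =
  inner (g i x) u v.
Hypothesis cov_A : forall i j x v, overlap i j x ->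
  A j (transition i j x) *m push i j x v = push i j x (A i x *m v).
Hypothesis cov_B : forall i j x v, overlap i j x ->
  B j (transition i j x) *m push i j x v = push i j x (B i x *m v).
Hypothesis cov_th : forall i j x v, overlap i j x ->
  th j (transition i j x) (push i j x v) = th i x v.

Let T i := lee_field (g i) (th i).
Let X i := Xfield (g i) (A i) (B i) (th i) (p \o chart_inv i).
Let Y i := Yfield (g i) (A i) (B i) (th i) (p \o chart_inv i).
Let Z i := Zfield (g i) (th i).
Let AY i y := A i y *m Y i y.

Section Overlap.
Variables (i j : chart_ix M) (x : 'cV[R]_4).
Hypothesis ijx : overlap i j x.
Let Ix : chart_img i x := ijx.1.
Let Jx : chart_img j (transition i j x) := transition_img ijx.

Lemma push_surj v : exists u, push i j x u = v.
Proof.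
pose Q := jac (transition i j) x.
have pE u : push i j x u = Q *m u.
  have oo : open (overlap i j) by exact: overlap_open.
  have st : smooth_mx_on (overlap i j) (transition i j) by exact: transition_smooth.
  exact: (derive_jac oo st u ijx).
have QE : Q^T *m g j (transition i j x) *m Q = g i x.
  apply/matrixP => a b; have := cov_g (evec a) (evec b) ijx.
  rewrite !pE /inner !trmx_mul !trmx_delta !mulmxA.
  rewrite -(mulmxA _ (Q^T)) -(mulmxA _ _ Q) -!rowE -!colE.
  by rewrite !mxE.
have uQ : Q \in unitmx.
  have := nc_unitG (NC i) Ix; rewrite -QE unitmx_mul => /andP[_ //].
by exists (invmx Q *m v); rewrite pE mulKVmx.
Qed.

Lemma cov_T : T j (transition i j x) = push i j x (T i x).
Proof.
apply/eqP; rewrite -subr_eq0; apply/eqP.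
apply: (inner_nondeg (nc_unitG (NC j) Jx)) => w.
have [v <-] := push_surj w.
rewrite (innerC _ _ (nc_symG (NC j) Jx)) innerBl cov_g//.
by rewrite /T (lee_fieldE (NC j))// (lee_fieldE (NC i))// cov_th// subrr.
Qed.

Let pE : (p \o chart_inv j) (transition i j x) = (p \o chart_inv i) x.
Proof. by rewrite /= transition_inv. Qed.

Lemma cov_X : X j (transition i j x) = push i j x (X i x).
Proof.
rewrite /X /Xfield -/(T _) !mulmxDl -!scalemxAl cov_T cov_A// cov_B//.
by rewrite pushD// pushZ// /fp /rootp pE.
Qed.

Lemma cov_Y : Y j (transition i j x) = push i j x (Y i x).
Proof.
rewrite /Y /Yfield /Kfield -/(T _) -!scalemxAl !mulmxBl -!mulmxA cov_T.
rewrite !(cov_A, cov_B)// pushD// pushZ// (pushD _ (- _))// pushN// /rootp pE.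
by [].
Qed.

Lemma cov_AY : AY j (transition i j x) = push i j x (AY i x).
Proof. by rewrite /AY cov_Y cov_A. Qed.

Lemma cov_Z : Z j (transition i j x) = push i j x (Z i x).
Proof. by rewrite /Z /Zfield -/(T _) cov_T cov_g// pushZ. Qed.

End Overlap.

Let sY i : smooth_mx_on (chart_img i) (Y i). Proof. exact: smooth_Yfield (NC i). Qed.
Let sAY i : smooth_mx_on (chart_img i) (AY i). Proof. exact: smooth_AY (NC i). Qed.
Let sZ i : smooth_mx_on (chart_img i) (Z i). Proof. exact: smooth_Zfield (NC i). Qed.

Definition twist i x := inner (g i x) (lie (Y i) (AY i) x) (Y i x).
(* As [g(Y, Z) = 1], if [nabla_Y Y = b Y] then [b = - g([Y, Z], Y)], an
   expression which is visibly independent of the chart. *)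
Definition geodesic_factor i x := - inner (g i x) (lie (Y i) (Z i) x) (Y i x).

Lemma cov_twist i j x : overlap i j x -> twist j (transition i j x) = twist i x.
Proof.
move=> ijx; rewrite /twist cov_Y// -[RHS](cov_g _ _ ijx); congr inner.
by apply: push_lie => // y ijy; [exact: cov_Y|exact: cov_AY].
Qed.

Lemma cov_geodesic_factor i j x : overlap i j x ->
  geodesic_factor j (transition i j x) = geodesic_factor i x.
Proof.
move=> ijx; rewrite /geodesic_factor cov_Y// -[in RHS](cov_g _ _ ijx).
congr (- inner _ _ _).
by apply: push_lie => // y ijy; [exact: cov_Y|exact: cov_Z].
Qed.

Lemma smooth_twist i : smooth_on (chart_img i) (twist i).
Proof.
have oi := nc_open (NC i); apply: smooth_on_inner => //; first exact: (nc_smoothG (NC i)).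
by apply: smooth_mx_onB => //; apply: smooth_mx_on_derive.
Qed.

Lemma smooth_geodesic_factor i : smooth_on (chart_img i) (geodesic_factor i).
Proof.
have oi := nc_open (NC i); apply: smooth_onN => //.
apply: smooth_on_inner => //; first exact: (nc_smoothG (NC i)).
by apply: smooth_mx_onB => //; apply: smooth_mx_on_derive.
Qed.

Let D i x := plane (X i) (Y i) x.

Lemma plane_distribution (U : set M) : tangent_distribution 2 U D.
Proof.
split.
- by move=> i x Ix _; apply: (rank2_plane (NC i)).
- move=> i x v Ix _ [a [b ->]]; exists (chart_img i), (fun y => a *: X i y + b *: Y i y).
  have oi := nc_open (NC i).
  split => //; split; last by move=> y _; exists a, b.
  by apply: smooth_mx_onD => //; apply: smooth_mx_onZ => //;
    [exact: smooth_on_cst|exact: smooth_Xfield (NC i)|exact: smooth_on_cst].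
- move=> i j x v ijx _ [a [b ->]]; exists a, b.
  by rewrite pushD// !pushZ// cov_X// cov_Y.
Qed.

Lemma plane_null : null_distribution g 2 D.
Proof.
split; first exact: plane_distribution.
move=> i x u v Ix [a [b ->]] [c [d ->]].
apply: inner_plane0; [exact: (cXX (NC i))|exact: (cXY (NC i))| |exact: (cYY (NC i))].
by rewrite (innerC _ _ (nc_symG (NC i) Ix)); exact: (cXY (NC i)).
Qed.

Lemma overlap_chart (i j : chart_ix M) (m : M) : chart_dom i m -> chart_dom j m ->
  overlap i j (chart_map i m) /\ transition i j (chart_map i m) = chart_map j m.
Proof.
move=> im jm; split; last by rewrite /transition /= chart_mapK.
by split; [exists m|rewrite /= chart_mapK].
Qed.

Definition twisted_locus : set M :=
  [set m | exists2 i, chart_dom i m & twist i (chart_map i m) != 0].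

Lemma twisted_locusP i x : chart_img i x -> twisted_locus (chart_inv i x) ->
  twist i x != 0.
Proof.
move=> Ix [j jm]; have im := chart_inv_dom Ix.
have [ov tE] := overlap_chart im jm.
by rewrite -tE cov_twist// chart_invK.
Qed.

Lemma twisted_locus_open : open twisted_locus.
Proof.
rewrite openE => m [i im h]; rewrite /interior /=.
have n1 : \forall y \near m, chart_dom i y.
  by apply: open_nbhs_nbhs; split => //; exact: chart_dom_open.
have Im : chart_img i (chart_map i m) by exists m.
have ct : {for m, continuous (twist i \o chart_map i)}.
  apply: continuous_comp; first exact: chart_map_continuous.
  exact: Ck_on_continuous (smooth_twist i 0) Im.
have n2 : \forall y \near m, twist i (chart_map i y) != 0.
  have o0 : open [set r : R | r != 0] by exact: open_neq.
  exact: (ct _ (open_nbhs_nbhs (conj o0 h))).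
by apply: filterS (filterI n1 n2) => y [iy hy]; exists i.
Qed.

Lemma plane_Engel : Engel_on twisted_locus D.
Proof.
split; first exact: plane_distribution.
move=> i x Ix Ux; split; first exact: (rank3_bracket (NC i)).
by apply: (rank4_bracket (NC i)) => //; exact: twisted_locusP.
Qed.

Lemma untwisted_geodesic : (forall i x, chart_img i x -> twist i x = 0) ->
  flow_of_null_geodesics g Y.
Proof.
move=> tw0; split; first by move=> i x Ix; exact: (cYY (NC i)).
pose ci (m : M) : chart_ix M := sval (cid (chart_dom_cover m)).
have ciP m : chart_dom (ci m) m := svalP (cid (chart_dom_cover m)).
pose F (m : M) := geodesic_factor (ci m) (chart_map (ci m) m).
have FE i x : chart_img i x -> F (chart_inv i x) = geodesic_factor i x.
  move=> Ix; rewrite /F; set m := chart_inv i x.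
  have [ov tE] := overlap_chart (chart_inv_dom Ix) (ciP m).
  by rewrite -tE cov_geodesic_factor// chart_invK.
exists F; split.
  move=> i; apply: smooth_on_eq (smooth_geodesic_factor i) => //.
    exact: nc_open (NC i).
  by move=> x Ix /=; rewrite FE.
move=> i x Ix; rewrite FE//.
exact: (conn_YY_geodesic (NC i) Ix (tw0 i x Ix)).
Qed.

Lemma Engel_or_geodesic : (exists U : set M, [/\ open U, U !=set0 & Engel_on U D]) \/
  flow_of_null_geodesics g Y.
Proof.
have [[m Um]|U0] := pselect (twisted_locus !=set0).
  left; exists twisted_locus; split; [exact: twisted_locus_open|by exists m|].
  exact: plane_Engel.
right; apply: untwisted_geodesic => i x Ix; apply/eqP; apply/negPn/negP => h.
apply: U0; exists (chart_inv i x), i; first exact: chart_inv_dom.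
by rewrite chart_invK.
Qed.

End Covariance.

Lemma kform1_linear (R : realType) (n : nat) (M : manifold R n)
    (w : chart_ix M -> 'cV[R]_n -> ('I_1 -> 'cV[R]_n) -> R) i x c u v :
  kform w -> chart_img i x ->
  w i x (fun=> c *: u + v) = c * w i x (fun=> u) + w i x (fun=> v).
Proof.
move=> [_ wl _ _] Ix; have := wl i x (fun=> 0) ord0 c u v Ix.
have E (z : 'cV[R]_n) :
    [eta (fun=> 0) with ord0 |-> z] = (fun=> z) :> ('I_1 -> 'cV[R]_n).
  by apply/funext => k /=; rewrite [k]ord1 eqxx.
by rewrite !E.
Qed.

Theorem theorem12 (R : realType) (M : manifold R 4)
    (g Jp Jm : chart_ix M -> 'cV[R]_4 -> 'M[R]_4)
    (b : chart_ix M -> 'cV[R]_4 -> ('I_2 -> 'cV[R]_4) -> R)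
    (H : chart_ix M -> 'cV[R]_4 -> ('I_3 -> 'cV[R]_4) -> R)
    (thetap thetam : chart_ix M -> 'cV[R]_4 -> ('I_1 -> 'cV[R]_4) -> R)
    (p : M -> R) :
  twisted_generalized_pseudo_Kahler g Jp Jm b H ->
  Lee_form g Jp thetap ->
  Lee_form g Jm thetam ->
  (forall i x v, chart_img i x -> thetap i x v = - thetam i x v) ->
  let T i x := sharp (g i x) (fun v => thetap i x (fun=> v)) in
  (forall i x, chart_img i x -> inner (g i x) (T i x) (T i x) != 0) ->
  (forall i x, chart_img i x ->
     Jp i x *m Jm i x + Jm i x *m Jp i x = (2 * p (chart_inv i x))%:M) ->
  (forall m, 1 < `|p m|) ->
  let s m := Num.sqrt (p m ^+ 2 - 1) in
  let f m := p m - s m in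
  let K i x := (2 * s (chart_inv i x))^-1 *:
                 (Jp i x *m Jm i x - Jm i x *m Jp i x) in
  let X i x := (Jp i x + f (chart_inv i x) *: Jm i x) *m T i x in
  let Y i x := T i x + K i x *m T i x in
  let D i x := [set v | exists c1 c2 : R, v = c1 *: X i x + c2 *: Y i x] in
  null_distribution g 2 D /\
  ((exists U : set M, [/\ open U, U !=set0 & Engel_on U D]) \/
   flow_of_null_geodesics g Y).
Proof.
move=> gpK [kth Lp] [_ Lm] thpm T T0 pE p1 s f K X Y D.
have [sg gs ug cg] := gpK_metric gpK.
have [[sJp cJp] Jp2 Np] := gpK_complexp gpK.
have [[sJm cJm] Jm2 Nm] := gpK_complexm gpK.
have [sth _ _ cth] := kth.
pose th i x v := thetap i x (fun=> v).
have NC i : null_chart (chart_img i) (g i) (Jp i) (Jm i) (th i) (p \o chart_inv i).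
  split.
  - exact: chart_img_open.
  - exact: sg.
  - exact: gs.
  - exact: ug.
  - exact: sJp.
  - exact: sJm.
  - exact: Jp2.
  - exact: Jm2.
  - by move=> x u v; exact: (gpK_compatp gpK).
  - by move=> x u v; exact: (gpK_compatm gpK).
  - by move=> x u v Ix; apply: Np => //; exact: smooth_mx_on_cst.
  - by move=> x u v Ix; apply: Nm => //; exact: smooth_mx_on_cst.
  - by move=> v; exact: sth.
  - by move=> x c u v Ix; exact: kform1_linear.
  - by move=> x v Ix; rewrite Lp.
  - move=> x v Ix; rewrite Lm//; apply: eq_bigr => k _.
    by rewrite /th thpm// opprK.
  - exact: pE.
  - by move=> x _; exact: p1.
  - exact: T0.
have cth1 i j x v : overlap i j x ->
    th j (transition i j x) (push i j x v) = th i x v.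
  by move=> ijx; exact: (cth i j x (fun=> v)).
split; first exact: (plane_null NC cg cJp cJm cth1).
exact: (Engel_or_geodesic NC cg cJp cJm cth1).
Qed.
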